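(* For every natural number $M$ there exist a power $q$ of $3$ and an elliptic curve over $\mathbb{F}_q(t)$ whose Mordell–Weil rank over $\mathbb{F}_q(t)$ equals $2\sqrt{q}$, with $2\sqrt{q}>M$.
   Context: $\mathbb{F}_q(t)$ is the rational function field in one variable over the finite field with $q$ elements. *)

(* Defs.v *)
From mathcomp Require Import all_boot all_order all_algebra ring.
From mathcomp Require Import realalg.

Set Implicit Arguments.
Unset Strict Implicit.
Unset Printing Implicit Defensive.

Import GRing.Theory.
Local Open Scope ring_scope.

Record weierstrass (K : fieldType) := Weierstrass {
  a1 : K; a2 : K; a3 : K; a4 : K; a6 : K
}.

Section Discriminant.
Variables (K : fieldType) (W : weierstrass K).

Definition b2 : K := a1 W ^+ 2 + 4 * a2 W.
Definition b4 : K := 2 * a4 W + a1 W * a3 W.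
Definition b6 : K := a3 W ^+ 2 + 4 * a6 W.
Definition b8 : K :=
  a1 W ^+ 2 * a6 W + 4 * a2 W * a6 W - a1 W * a3 W * a4 W
  + a2 W * a3 W ^+ 2 - a4 W ^+ 2.

Definition discriminant : K :=
  - b2 ^+ 2 * b8 - 8 * b4 ^+ 3 - 27 * b6 ^+ 2 + 9 * b2 * b4 * b6.

End Discriminant.

(* Every elliptic curve over K (a smooth projective curve of genus 1 with a   *)
(* K-rational point) has a Weierstrass model over K; the model is smooth      *)
(* exactly when its discriminant is nonzero. The general five-coefficient     *)
(* form is used because it is valid in every characteristic.                  *)
Record elliptic_curve (K : fieldType) := EllipticCurve {
  curve :> weierstrass K;
  discriminant_neq0 : discriminant curve != 0
}.

Section Points.
Variables (K : fieldType) (E : elliptic_curve K).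

(* [None] is the point at infinity, [Some (x, y)] an affine point. *)
Definition on_curve (P : option (K * K)) : bool :=
  if P is Some (x, y) then
    y ^+ 2 + a1 E * x * y + a3 E * y == x ^+ 3 + a2 E * x ^+ 2 + a4 E * x + a6 E
  else true.

Definition point := {P : option (K * K) | on_curve P}.

Definition opp_coord (P : option (K * K)) : option (K * K) :=
  if P is Some (x, y) then Some (x, - y - a1 E * x - a3 E) else None.

(* The slope of the chord through two points, or of the tangent if they agree; *)
(* only meaningful for points that are not opposite to each other.             *)
Definition slope (x1 y1 x2 y2 : K) : K :=
  if x1 == x2 then
    (3 * x1 ^+ 2 + 2 * a2 E * x1 + a4 E - a1 E * y1)
      / (2 * y1 + a1 E * x1 + a3 E)
  else (y2 - y1) / (x2 - x1).

Definition add_coord (P Q : option (K * K)) : option (K * K) :=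
  match P, Q with
  | None, _ => Q
  | _, None => P
  | Some (x1, y1), Some (x2, y2) =>
      if P == opp_coord Q then None
      else
        let l := slope x1 y1 x2 y2 in
        let x3 := l ^+ 2 + a1 E * l - a2 E - x1 - x2 in
        opp_coord (Some (x3, l * (x3 - x1) + y1))
  end.

Lemma on_curve_opp P : on_curve P -> on_curve (opp_coord P).
Proof.
case: P => [[x y]|] //= /eqP h; apply/eqP; rewrite -h; ring.
Qed.

Lemma on_curve_third (l x1 y1 x2 : K)
    (x3 := l ^+ 2 + a1 E * l - a2 E - x1 - x2) :
  on_curve (Some (x1, y1)) ->
  2 * l * y1 + a1 E * y1 + a1 E * l * x2 + a3 E * l + l ^+ 2 * (x2 - x1)
    - (x1 ^+ 2 + x1 * x2 + x2 ^+ 2) - a2 E * (x1 + x2) - a4 E = 0 ->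
  on_curve (Some (x3, l * (x3 - x1) + y1)).
Proof.
rewrite /on_curve -subr_eq0 => /eqP h1 h2; rewrite -subr_eq0; apply/eqP.
transitivity (0 + (x3 - x1) * 0 : K); last by rewrite mulr0 addr0.
by rewrite -{1}h1 -{1}h2 /x3; ring.
Qed.

Lemma on_curve_add P Q :
  on_curve P -> on_curve Q -> on_curve (add_coord P Q).
Proof.
case: P => [[x1 y1]|] //; case: Q => [[x2 y2]|] // h1 h2.
rewrite /add_coord; case: ifPn => // hPQ.
apply: on_curve_opp; apply: on_curve_third => //.
move: h1 h2; rewrite /on_curve -subr_eq0 => /eqP h1.
rewrite -subr_eq0 => /eqP h2; rewrite /slope; case: eqVneq => [e|ne].
  subst x2.
  have ny : y1 - (- y2 - a1 E * x1 - a3 E) != 0.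
    by apply: contra hPQ; rewrite subr_eq0 => /eqP ->.
  have ey : y1 = y2.
    apply/eqP; rewrite -subr_eq0 -(mulIr_eq0 _ (mulIf ny)); apply/eqP.
    by rewrite -[RHS](subrr 0) -{1}h1 -h2; ring.
  subst y2; field.
  by move: ny; congr (_ != 0); ring.
have nz : x2 - x1 != 0 by rewrite subr_eq0 eq_sym.
apply: (mulIf nz); rewrite mul0r -[RHS](subrr 0) -{1}h2 -h1; field.
exact: nz.
Qed.

Definition zero_point : point := exist _ None isT.
Definition opp_point (P : point) : point :=
  exist _ (opp_coord (val P)) (on_curve_opp (valP P)).
Definition add_point (P Q : point) : point :=
  exist _ (add_coord (val P) (val Q)) (on_curve_add (valP P) (valP Q)).

Definition mulz_point (m : int) (P : point) : point :=
  match m with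
  | Posz n => iter n (add_point P) zero_point
  | Negz n => opp_point (iter n.+1 (add_point P) zero_point)
  end.

Definition independent (n : nat) (P : 'I_n -> point) : Prop :=
  forall m : 'I_n -> int,
    \big[add_point/zero_point]_(i < n) mulz_point (m i) (P i) = zero_point -> forall i, m i = 0.

(* The rank of an abelian group is the largest size of a Z-linearly          *)
(* independent family; for the finitely generated group E(K) it is the rank  *)
(* of the free part.                                                         *)
Definition mordell_weil_rank (r : nat) : Prop :=
  (exists P : 'I_r -> point, independent P) /\
  (forall (n : nat) (P : 'I_n -> point), independent P -> (n <= r)%N).

End Points.

(* Main.v *)
Require Import Defs.
From HB Require Import structures.
From mathcomp Require Import all_boot all_order all_algebra all_field ring zify.
From mathcomp Require Import realalg.

(** Let s = 3^m with m odd, q = s^2 and F = F_q. Choose d in F with d^4 = -1, put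
    i = d^2 and T = t^s - t, and consider over K = F(t) the curve

      E : y^2 = x^3 - x + b,   b = i T^2 = (d T)^2.

    Its rank is 2 s. Up to a change of x, b is a multiple of t^(s+1), so E is the
    twist of the supersingular curve y^2 = x^3 - x by the Artin-Schreier cover
    u^3 - u = -b, a quotient of a Hermitian curve. The proof below is elementary: it
    uses neither L-functions nor Jacobians.

    Endomorphisms. As x^3 - x is additive in characteristic 3, any endomorphism f of
    the field K and any e in K with e^3 - e = f(b) - b give a group endomorphism
    (x, y) -> (f(x) + e, f(y)) of E(K) ([twist]). Four families are used:
    - zeta : (x, y) -> (x + 1, y), with 1 + zeta + zeta^2 = 0;
    - phi : (x, y) -> (x^3 + b, y^3), equal to zeta^2 - zeta, so that phi^2 = -3;
    - [translate w], which is t -> t + w with e = 0, for w in the subfield F_s;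
    - [heis u], which is t -> t + i u with e = Tr(u t - i u^2), for u in F_s, where
      Tr z is the sum of the z^(3^k) for k < m.
    The last two commute up to zeta^(Tr(u w)): they generate a Heisenberg group of
    order 3 q acting on E(K), whose centre acts through zeta. An extraspecial group of
    this order has only one irreducible representation over Q(zeta) with this central
    character, and its dimension is s. So E(K) has rank 2 s times the rank over
    Z[zeta] of the points fixed by all translations. In explicit form,
    s P is the sum over u of [heis u] applied to the trace over F_s of [heis (-u)] P
    ([trace_decomposition]), and the same orthogonality of characters separates the
    orbit of a fixed point ([generator_free]).

    The fixed points. They contain P0 = (0, d T), and Z[zeta] P0 has finite index up
    to torsion ([invariant_torsion_mod]). Three collinear points satisfy
    y1 + y2 + y3 = l^3, with l the slope of the line, so y induces a homomorphism
    from E(K) to K/K^3; its kernel is the image of phi ([phi_descent]). Writing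
    x = X/D^2, y = Y/D^3 and differentiating the equation shows that y' is a
    polynomial, and comparing degrees and leading coefficients shows that for a fixed
    point y' is 0, d or -d ([deriv_reduced]). Here (d T)' = -d, hence every fixed
    point Q is phi Q' - e P0 for some e in {0, 1, -1}. The height of Q' is about two
    thirds of that of Q ([descent]); so iterating ends among the finitely many points
    of small height, where it must cycle, and phi^(2r) Q = Q modulo Z[zeta] P0 means
    that 1 - (-3)^r kills Q modulo Z[zeta] P0. Finally P0 has infinite order because
    d T is not a cube. *)

Set Implicit Arguments.
Unset Strict Implicit.
Unset Printing Implicit Defensive.

Import Order.TTheory GRing.Theory Num.Theory.
Local Open Scope ring_scope.

Local Notation "x %:F" := (@tofrac _ x).

(** * Linear combinations of equations *)

Section LinearCombination.
Variable K : pzRingType.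
Implicit Types a b c d : K.

Lemma eq_scale c a b : a = b -> c * a = c * b. Proof. by move->. Qed.

Lemma eq_plus a b c d : a = b -> c = d -> a + c = b + d.
Proof. by move=> -> ->. Qed.

Lemma eq_of_combination a b c d : c = d -> a - b = c - d -> a = b.
Proof. by move=> -> /eqP; rewrite subrr subr_eq0 => /eqP. Qed.
End LinearCombination.

Local Notation "c *e h" := (eq_scale c h) (at level 40).
Local Notation "h +e k" := (eq_plus h k) (at level 50).

(** Proves an equation from a combination c1 *e h1 +e c2 *e h2 +e ... of known ones;
    characteristic 3 enters as the equation 3 = 0. *)
Ltac combine h := apply: (eq_of_combination h); ring.

(** * The group law of y^2 = x^3 - x + b in characteristic 3 *)

Section GroupLaw.
Variables (K : fieldType) (three0 : 3 = 0 :> K) (b : K).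

Lemma as_discriminant_neq0 : discriminant (Weierstrass 0 0 0 (-1) b) != 0 :> K.
Proof.
apply/eqP => h; have /eqP := oner_neq0 K; apply.
rewrite -h /discriminant /b2 /b4 /b6 /b8 /=.
by combine ((-21 + 144 * b ^+ 2) *e three0).
Qed.

Definition as_curve : elliptic_curve K := EllipticCurve as_discriminant_neq0.

(** The slope l of the line through P and Q. For distinct x-coordinates the first equation
    determines l and implies the second; for P = Q the first is void and the second gives
    the tangent. Together they exclude Q = - P, where the second would read 0 = -1. This
    uniform description avoids separating chords from tangents. *)
Definition chord (l : K) (P Q : K * K) : Prop :=
  l * (P.1 - Q.1) = P.2 - Q.2 /\ l * (P.2 + Q.2) = (P.1 - Q.1) ^+ 2 - 1.

(** In characteristic 3 the third point of the line has y-coordinate l^3 - y1 - y2: the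
    three y-coordinates add up to the cube of the slope. *)
Definition chord_sum (l : K) (P Q : K * K) : K * K :=
  (l ^+ 2 - P.1 - Q.1, P.2 + Q.2 - l ^+ 3).

Lemma oppE P : opp_coord as_curve P = if P is Some (x, y) then Some (x, - y) else None.
Proof. by case: P => [[x y]|] //=; rewrite mul0r !subr0. Qed.

Lemma chord_sym l P Q : chord l P Q -> chord l Q P.
Proof.
case=> h1 h2; split; first by combine (-1 *e h1).
by combine (1 *e h2).
Qed.

Lemma chord_sum_sym l P Q : chord_sum l P Q = chord_sum l Q P.
Proof. by congr (_, _); ring. Qed.

Lemma two_neq0 : 2 != 0 :> K.
Proof.
apply/eqP => h2; have /eqP := oner_neq0 K; apply.
by combine (-1 *e h2 +e 1 *e three0).
Qed.

Lemma add_coordE x1 y1 x2 y2 l : slope as_curve x1 y1 x2 y2 = l ->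
  add_coord as_curve (Some (x1, y1)) (Some (x2, y2)) =
  if (x1, y1) == (x2, - y2) then None
  else Some (l ^+ 2 - x1 - x2, - (l * (l ^+ 2 - x1 - x2 - x1) + y1)).
Proof. by rewrite /add_coord /= => ->; rewrite !(mul0r, addr0, subr0). Qed.

Lemma chord_add l P Q : chord l P Q ->
  add_coord as_curve (Some P) (Some Q) = Some (chord_sum l P Q).
Proof.
case: P Q => [x1 y1] [x2 y2] [h1 h2]; rewrite (add_coordE (erefl _)); simpl in h1, h2.
case: eqP => [[e1 e2]|_].
  by case/eqP: (oner_neq0 K); move: h2; rewrite e1 e2 => h2; combine (1 *e h2).
suff -> : slope as_curve x1 y1 x2 y2 = l.
  rewrite /chord_sum /=; congr (Some (_, _)).
  by combine (-1 *e h1 +e (l * x1 - y1) *e three0).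
rewrite /slope /=; case: eqVneq => [e|ne].
  have ey : y1 = y2 by move: h1; rewrite e subrr mulr0 => /esym/eqP; rewrite subr_eq0 => /eqP.
  move: h2; rewrite -e -ey => h2.
  have ny : y1 != 0.
    apply/eqP => y0; case/eqP: (oner_neq0 K); move: h2; rewrite y0 => h2.
    by combine (1 *e h2).
  have n2 := two_neq0.
  rewrite three0; apply: (mulIf (mulf_neq0 n2 ny)).
  rewrite !(mul0r, mulr0, add0r, addr0, subr0) -mulrA mulVf ?mulf_neq0 //.
  by combine (-1 *e h2).
have nz : x2 - x1 != 0 by rewrite subr_eq0 eq_sym.
apply: (mulIf nz); rewrite divfK //; combine (1 *e h1).
Qed.

Definition on_as_curve (P : K * K) : Prop := P.2 ^+ 2 = P.1 ^+ 3 - P.1 + b.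

Lemma on_curveE P : on_curve as_curve (Some P) <-> on_as_curve P.
Proof.
case: P => x y; rewrite /on_curve /on_as_curve /= !(mul0r, addr0, mulN1r).
by split=> [/eqP|->].
Qed.

Lemma opp_or_chord P Q : on_as_curve P -> on_as_curve Q ->
  Q = (P.1, - P.2) \/ exists l, chord l P Q.
Proof.
case: P Q => [x1 y1] [x2 y2]; rewrite /on_as_curve => h1 h2; simpl in h1, h2.
have [ex|nx] := eqVneq x1 x2; last first.
  have nz : x1 - x2 != 0 by rewrite subr_eq0.
  right; exists ((y1 - y2) / (x1 - x2)); split=> /=; first by rewrite divfK.
  apply: (mulIf nz); rewrite mulrAC divfK //.
  by combine (1 *e h1 +e -1 *e h2 +e (x1 * x2 * (x1 - x2)) *e three0).
have [ey|ny] := eqVneq y1 (- y2); first by left; rewrite ex ey opprK.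
have nz : y1 + y2 != 0 by rewrite -[y2]opprK subr_eq0.
right; exists (-1 / (y1 + y2)); split=> /=; last by rewrite divfK // ex; ring.
rewrite ex subrr mulr0; apply: (mulIf nz); rewrite mul0r; move: h1; rewrite ex => h1.
by combine (1 *e h2 +e -1 *e h1).
Qed.

(** The identity behind associativity, as a combination of the equations of three chords. It
    describes three points P, Q, R with x(P) - x(Q) = p,
    x(R) - x(Q) = r and y(Q) = y: l is the slope of PQ, m that of QR, and k that of the line
    through P + Q and R. *)
Lemma slope_difference (p r y l m k : K) :
    l ^+ 2 * p - l * y = p ^+ 2 - 1 ->
    m ^+ 2 * r - m * y = r ^+ 2 - 1 ->
    k * (l ^+ 2 - p - r) = y + l * p - l ^+ 3 - m * r ->
    k * (l * p - l ^+ 3 + m * r) = (l ^+ 2 - p - r) ^+ 2 - 1 ->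
  (l + k) * (l - m) = p - r.
Proof.
move=> g1 g2 g3 g4.
by combine ((r - m * k) *e g1 +e (- p + r + l ^+ 2 + l * k) *e g2
  +e (p * m - r * l - r * m - l ^+ 2 * m) *e g3 +e (- r - l * m) *e g4
  +e (- p * r ^+ 2 - p * r * l * m + r ^+ 2 * l ^+ 2 + r * l ^+ 3 * m) *e three0).
Qed.

(** The slopes form a 2-cocycle: slope(P,Q) + slope(P+Q,R) = slope(Q,R) + slope(P,Q+R).
    Hence the y-coordinates of the two triple sums, which differ from y1 + y2 + y3 by the
    cubes of these sums of slopes, agree; for the x-coordinates this is [slope_difference]. *)
Lemma chord_assoc l m k P Q R : chord l P Q -> chord m Q R -> chord k (chord_sum l P Q) R ->
  let n := k + l - m in
  chord n P (chord_sum m Q R) /\ chord_sum k (chord_sum l P Q) R = chord_sum n P (chord_sum m Q R).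
Proof.
case: P Q R => [x1 y1] [x2 y2] [x3 y3] [/= a1 a2] [/= b1 b2] [/= c1 c2].
have key : (l + k) * (l - m) = x1 - x3.
  have -> : x1 - x3 = (x1 - x2) - (x3 - x2) by ring.
  apply: (@slope_difference _ _ y2).
  - by combine (1 *e a2 +e l *e a1 +e (- l * y2) *e three0).
  - by combine (1 *e b2 +e (- m) *e b1 +e (- m * y2) *e three0).
  - by combine (1 *e c1 +e -1 *e a1 +e -1 *e b1 +e (k * x2) *e three0).
  combine (1 *e c2 +e k *e a1 +e (- k) *e b1
    +e (- k * y2 - 2 * x2 * (l ^+ 2 - x1 - x2 - x3) - 3 * x2 ^+ 2) *e three0).
split; first split=> /=.
- by combine (-1 *e c1 +e (l + m) *e key +e -1 *e a1 +e -1 *e b1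
    +e (l * x1 - m * x3 - y1 + y3) *e three0).
- by combine (1 *e c2 +e (l ^+ 2 + l * m + m ^+ 2) *e key +e (m - l) *e a1 +e (l - m) *e b1
    +e ((l - m) * y2 + m ^+ 2 * x1 - l ^+ 2 * x3 - (l ^+ 2 - m ^+ 2) * x2) *e three0).
congr (_, _) => /=; first by combine (-2 *e key).
by combine ((k ^+ 2 * (l - m) + k * (l - m) ^+ 2 - l ^+ 2 * m + l * m ^+ 2) *e three0).
Qed.

Local Notation add := (add_coord as_curve).
Local Notation opp := (opp_coord as_curve).
Local Notation on := (on_curve as_curve).

Lemma coord_add0 P : add None P = P. Proof. by case: P. Qed.
Lemma coord_addr0 P : add P None = P. Proof. by case: P => [[]|]. Qed.

Lemma coord_oppK P : opp (opp P) = P.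
Proof. by rewrite !oppE; case: P => [[x y]|] //; rewrite opprK. Qed.

Lemma coord_addrN P : add P (opp P) = None.
Proof. by rewrite oppE; case: P => [[x y]|] //; rewrite (add_coordE (erefl _)) opprK eqxx. Qed.

Lemma coord_addC P Q : on P -> on Q -> add P Q = add Q P.
Proof.
case: P Q => [P|] [Q|]; rewrite ?coord_add0 ?coord_addr0 // => /on_curveE oP /on_curveE oQ.
case: (opp_or_chord oP oQ) => [->|[l c]].
  have -> : Some (P.1, - P.2) = opp (Some P) by rewrite oppE; case: (P).
  by rewrite coord_addrN -{2}[Some P]coord_oppK coord_addrN.
by rewrite (chord_add c) (chord_add (chord_sym c)) chord_sum_sym.
Qed.

Lemma chord_opp l P Q : chord l P Q -> chord (- l) (chord_sum l P Q) (Q.1, - Q.2).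
Proof.
case=> h1 h2; split=> /=.
  by combine (1 *e h1 +e (l * Q.1 - Q.2) *e three0).
by combine (1 *e h2 +e (2 * l) *e h1 +e (2 * l ^+ 2 * Q.1
  - 2 * (P.1 - Q.1) * Q.1 - 3 * Q.1 ^+ 2 - l * Q.2) *e three0).
Qed.

Lemma coord_addK P Q : on P -> on Q -> add (add P Q) (opp Q) = P.
Proof.
case: Q => [Q|] oP oQ; last by rewrite !coord_addr0.
case: P oP => [P|] oP; last by rewrite coord_add0 coord_addrN.
case: (opp_or_chord (iffLR (on_curveE _) oP) (iffLR (on_curveE _) oQ)) => [eQ|[l c]].
  have -> : Some Q = opp (Some P) by rewrite oppE eQ; case: (P).
  by rewrite coord_addrN coord_oppK.
rewrite (chord_add c) oppE {2}[Q]surjective_pairing (chord_add (chord_opp c)).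
case: P Q {oP oQ c} => [x1 y1] [x2 y2]; congr (Some (_, _)) => /=; ring.
Qed.

Lemma coord_oppD P Q : on P -> on Q -> opp (add P Q) = add (opp P) (opp Q).
Proof.
case: P Q => [P|] [Q|]; rewrite ?coord_add0 ?coord_addr0 // => /on_curveE oP /on_curveE oQ.
case: (opp_or_chord oP oQ) => [->|[l [h1 h2]]].
  have -> : Some (P.1, - P.2) = opp (Some P) by rewrite oppE; case: (P).
  by rewrite !coord_addrN.
rewrite (chord_add (conj h1 h2)).
have c : chord (- l) (P.1, - P.2) (Q.1, - Q.2).
  by split=> /=; [combine (-1 *e h1)|combine (1 *e h2)].
rewrite !oppE; case: P Q {oP oQ h1 h2} c => [x1 y1] [x2 y2] c.
by rewrite (chord_add c); congr (Some (_, _)) => /=; ring.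
Qed.

Lemma coord_addNK P Q : on P -> on Q -> add (opp P) (add P Q) = Q.
Proof.
move=> oP oQ; rewrite coord_addC ?on_curve_opp ?on_curve_add // (coord_addC oP oQ).
exact: coord_addK.
Qed.

Lemma coord_addVK P Q : on P -> on Q -> add P (add (opp P) Q) = Q.
Proof. by move=> oP oQ; have := coord_addNK (on_curve_opp oP) oQ; rewrite coord_oppK. Qed.

(** The generic case is [chord_assoc]; when a partial sum is zero, cancellation decides. *)
Lemma coord_addA P Q R : on P -> on Q -> on R -> add P (add Q R) = add (add P Q) R.
Proof.
move=> oP oQ oR; have oA := on_curve_add oP oQ.
have oNP := on_curve_opp oP; have oNQ := on_curve_opp oQ.
case: P oP oA oNP => [P|] oP oA oNP; last by rewrite !coord_add0.
case: Q oQ oA oNQ => [Q|] oQ oA oNQ; last by rewrite coord_add0 coord_addr0.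
case: R oR => [R|] oR; last by rewrite !coord_addr0.
have [/on_curveE hP /on_curveE hQ /on_curveE hR] := And3 oP oQ oR.
have [eQ|[l cl]] := opp_or_chord hP hQ.
  have -> : Some P = opp (Some Q) by rewrite oppE eQ opprK -surjective_pairing.
  by rewrite coord_addNK // [add (opp _) _]coord_addC // coord_addrN coord_add0.
have [eR|[m cm]] := opp_or_chord hQ hR.
  have -> : Some R = opp (Some Q) by rewrite oppE eR; case: (Q).
  by rewrite coord_addK // coord_addrN coord_addr0.
have eA := chord_add cl; have eB := chord_add cm.
move: oA; rewrite eA => /on_curveE hA.
have [eR|[k ck]] := opp_or_chord hA hR.
  have eR' : Some R = opp (add (Some P) (Some Q)) by rewrite eA oppE eR; case: (chord_sum l P Q).
  have -> : add (Some Q) (Some R) = opp (Some P).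
    by rewrite eR' coord_oppD // [add (opp _) _]coord_addC // coord_addVK.
  by rewrite coord_addrN -eA eR' coord_addrN.
by rewrite eB (chord_add ck); have [cn ->] := chord_assoc cl cm ck; rewrite (chord_add cn).
Qed.
End GroupLaw.

(** * Points as an abelian group *)

(** A copy of the type of points that carries the group structure. *)
Definition as_point (K : fieldType) (three0 : 3 = 0 :> K) (b : K) : Type :=
  point (as_curve three0 b).

Lemma pchar3 (K : fieldType) : 3 = 0 :> K -> 3 \in [pchar K].
Proof. by move=> h; rewrite inE /= h eqxx. Qed.

Section PointGroup.
Variables (K : fieldType) (three0 : 3 = 0 :> K) (b : K).
Local Notation E := (as_curve three0 b).
Local Notation as_point := (as_point three0 b).

HB.instance Definition _ := Choice.copy as_point {P : option (K * K) | on_curve E P}.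

Lemma add_pointA : associative (@add_point K E).
Proof. by move=> P Q R; apply/val_inj/coord_addA; apply: valP. Qed.
Lemma add_pointC : commutative (@add_point K E).
Proof. by move=> P Q; apply/val_inj/coord_addC; apply: valP. Qed.
Lemma add_point0 : left_id (zero_point E) (@add_point K E).
Proof. by move=> P; apply/val_inj/coord_add0. Qed.
Lemma add_pointN : left_inverse (zero_point E) (@opp_point K E) (@add_point K E).
Proof. by move=> P; rewrite add_pointC; apply/val_inj/coord_addrN. Qed.

HB.instance Definition _ :=
  GRing.isZmodule.Build as_point add_pointA add_pointC add_point0 add_pointN.

Lemma mulz_pointE (m : int) (P : as_point) : mulz_point m P = P *~ m.
Proof.
have iterE n : iter n (add_point P) (zero_point E) = P *+ n :> as_point.
  by elim: n => [|n IH] //; rewrite iterS IH mulrS.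
by case: m => n; rewrite /mulz_point iterE.
Qed.

Definition affine_pt (x y : K) (h : y ^+ 2 = x ^+ 3 - x + b) : as_point :=
  exist _ (Some (x, y)) (iffRL (on_curveE three0 b (x, y)) h).

Variant pt_spec : as_point -> Prop :=
| PtZero : pt_spec 0
| PtAffine x y (h : y ^+ 2 = x ^+ 3 - x + b) : pt_spec (affine_pt h).

Lemma ptP (P : as_point) : pt_spec P.
Proof.
case: P => [[[x y]|] h]; last first.
  by have -> : exist _ None h = 0 :> as_point; [apply: val_inj|constructor].
have h' := iffLR (on_curveE three0 b (x, y)) h.
by have -> : exist _ (Some (x, y)) h = affine_pt h'; [apply: val_inj|constructor].
Qed.

(** The proofs that the points lie on the curve are equalities of booleans, hence irrelevant. *)
Lemma eq_affine_pt x y h x' y' h' : x = x' -> y = y' -> @affine_pt x y h = @affine_pt x' y' h'.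
Proof. by move=> ex ey; apply: val_inj; rewrite /= ex ey. Qed.

Lemma opp_affine_pt x y h : exists h', - @affine_pt x y h = @affine_pt x (- y) h'.
Proof.
have h' : (- y) ^+ 2 = x ^+ 3 - x + b by rewrite sqrrN.
by exists h'; apply: val_inj; rewrite /= mul0r !subr0.
Qed.

Lemma add_affine_pt l x y h x' y' h' : chord l (x, y) (x', y') ->
  exists h'', @affine_pt x y h + @affine_pt x' y' h' =
              @affine_pt (l ^+ 2 - x - x') (y + y' - l ^+ 3) h''.
Proof.
move=> c; have e := chord_add three0 b c.
have o : on_curve E (Some (chord_sum l (x, y) (x', y'))).
  by rewrite -e; apply: on_curve_add; apply/on_curveE.
by exists (iffLR (on_curveE three0 b (chord_sum l (x, y) (x', y'))) o); apply: val_inj.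
Qed.

(** * Endomorphisms *)

Section Twist.
Variables (f : {rmorphism K -> K}) (e : K) (he : e ^+ 3 - e + b = f b).

(** Cubing is additive, so adding e to x changes x^3 - x by e^3 - e. *)
Lemma twist_on x y : y ^+ 2 = x ^+ 3 - x + b ->
  f y ^+ 2 = (f x + e) ^+ 3 - (f x + e) + b.
Proof.
move=> h; have {}h : f y ^+ 2 = f x ^+ 3 - f x + f b.
  by rewrite -!(rmorphXn, rmorphD, rmorphN) h !(rmorphXn, rmorphD, rmorphN).
by combine (1 *e h +e -1 *e he +e (- f x * e * (f x + e)) *e three0).
Qed.

Definition twist_coord (P : option (K * K)) : option (K * K) :=
  if P is Some (x, y) then Some (f x + e, f y) else None.

Lemma twist_coord_on P : on_curve E P -> on_curve E (twist_coord P).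
Proof. by case: P => [[x y]|] // /on_curveE /twist_on h; apply/on_curveE. Qed.

Definition twist (P : as_point) : as_point :=
  exist _ (twist_coord (val P)) (twist_coord_on (valP P)).

Lemma twist_affine x y h : exists h', twist (@affine_pt x y h) = @affine_pt (f x + e) (f y) h'.
Proof. by exists (twist_on h); apply: val_inj. Qed.

Lemma twist0 : twist 0 = 0. Proof. exact: val_inj. Qed.

(** f maps chords to chords, and the translation by e does not change differences of
    x-coordinates; x1 + x2 + x3 is moved by 3 e = 0. *)
Lemma twistD : {morph twist : P Q / P + Q}.
Proof.
move=> P Q; case: (ptP P) => [|x y h]; first by rewrite twist0 !add0r.
case: (ptP Q) => [|x' y' h']; first by rewrite twist0 !addr0.
have [tx ->] := twist_affine h; have [tx' ->] := twist_affine h'.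
have [[ex ey]|[l c]] := opp_or_chord three0
  (h : on_as_curve b (x, y)) (h' : on_as_curve b (x', y')).
  subst x' y'.
  have [n1 e1] := opp_affine_pt h; have [n2 e2] := opp_affine_pt tx.
  rewrite (eq_affine_pt h' n1) // -e1 subrr twist0.
  by rewrite (eq_affine_pt tx' n2) ?rmorphN // -e2 subrr.
have c' : chord (f l) (f x + e, f y) (f x' + e, f y').
  case: c => h1 h2; simpl in h1, h2; split=> /=.
    by rewrite opprD addrACA subrr addr0 -!(rmorphM, rmorphB) h1.
  rewrite opprD addrACA subrr addr0 -(rmorphD f) -(rmorphB f) -(rmorphXn f).
  by rewrite -(rmorphM f) h2 rmorphB rmorph1.
have [s ->] := add_affine_pt h h' c; have [s' ->] := add_affine_pt tx tx' c'.
have [s'' ->] := twist_affine s; apply: eq_affine_pt.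
  by rewrite !rmorphB rmorphXn; combine (e *e three0).
by rewrite rmorphB rmorphD rmorphXn.
Qed.

HB.instance Definition _ := GRing.isNmodMorphism.Build as_point as_point twist (conj twist0 twistD).

End Twist.

Lemma twist_inj f e he : injective (@twist f e he).
Proof.
move=> P Q; case: (ptP P) => [|x y h]; case: (ptP Q) => [|x' y' h'] // /(congr1 val) //= [].
by move=> /addIr /fmorph_inj ex /fmorph_inj ey; apply: eq_affine_pt.
Qed.

Lemma twist_comp (f1 f2 f3 : {rmorphism K -> K}) e1 h1 e2 h2 e3 h3 :
   (forall x, f1 (f2 x) = f3 x) -> f1 e2 + e1 = e3 ->
  forall P, @twist f1 e1 h1 (@twist f2 e2 h2 P) = @twist f3 e3 h3 P.
Proof.
move=> ef ee P; apply: val_inj; case: P => [[[x y]|] h] //=.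
by rewrite rmorphD /= -addrA ee !ef.
Qed.

Lemma twist_ext (f1 f2 : {rmorphism K -> K}) e1 h1 e2 h2 : f1 =1 f2 -> e1 = e2 ->
  forall P, @twist f1 e1 h1 P = @twist f2 e2 h2 P.
Proof. by move=> ef ee P; apply: val_inj; case: P => [[[x y]|] h] //=; rewrite ee !ef. Qed.

Lemma twist_id (f : {rmorphism K -> K}) e h : (forall x, f x = x) -> e = 0 ->
  forall P, @twist f e h P = P.
Proof.
by move=> ef e0 P; apply: val_inj; case: P => [[[x y]|] ?] //=; rewrite e0 addr0 !ef.
Qed.

Lemma tau_eq e : e ^+ 3 = e -> e ^+ 3 - e + b = (idfun : {rmorphism K -> K}) b.
Proof. by move->; rewrite subrr add0r. Qed.

(** Translation of x by an element e of the prime field. *)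
Definition tau e (h : e ^+ 3 = e) : as_point -> as_point := twist (tau_eq h).

Definition zeta : as_point -> as_point := tau (expr1n K 3).
HB.instance Definition _ := GRing.Additive.on zeta.

Lemma zeta_affine x y h : exists h', zeta (@affine_pt x y h) = @affine_pt (x + 1) y h'.
Proof. by case: (twist_affine (tau_eq (expr1n K 3)) h) => h' e; exists h'; exact: e. Qed.

Lemma tauD e1 h1 e2 h2 e3 h3 : e1 + e2 = e3 ->
  forall P, @tau e1 h1 (@tau e2 h2 P) = @tau e3 h3 P.
Proof. by move=> ee; apply: twist_comp; rewrite // addrC. Qed.

Lemma tau0 e h : e = 0 -> forall P, @tau e h P = P.
Proof. by move=> e0; apply: twist_id. Qed.

Lemma twist_tau (f : {rmorphism K -> K}) c hc e (h : e ^+ 3 = e) :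
  f e = e -> forall P, @twist f c hc (tau h P) = tau h (twist hc P).
Proof.
move=> fe P; apply: val_inj; case: P => [[[x y]|] ?] //=.
by rewrite rmorphD /= fe addrAC.
Qed.

(** P, zeta P and zeta^2 P lie on a horizontal line. *)
Lemma sum_zeta P : P + zeta P + zeta (zeta P) = 0.
Proof.
case: (ptP P) => [|x y h]; first by rewrite !raddf0 !addr0.
have [h1 ->] := zeta_affine h.
have [h2 ->] := zeta_affine h1.
have c : chord 0 (x, y) (x + 1, y).
  by split=> /=; ring.
have [h3 ->] := add_affine_pt h h1 c.
have [h4 e4] := opp_affine_pt h2.
rewrite (eq_affine_pt h3 h4) -?e4 ?addNr //=.
  by combine ((- x - 1) *e three0).
by combine (y *e three0).
Qed.

Lemma phi_eq : b ^+ 3 - b + b = (pFrobenius_aut (pchar3 three0)) b.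
Proof. by rewrite subrK. Qed.

(** Frobenius maps the curve to y^2 = x^3 - x + b^3, and adding b to x brings it back. *)
Definition phi : as_point -> as_point := twist phi_eq.
HB.instance Definition _ := GRing.Additive.on phi.

Lemma phi_affine x y h : exists h', phi (@affine_pt x y h) = @affine_pt (x ^+ 3 + b) (y ^+ 3) h'.
Proof. by case: (twist_affine phi_eq h) => h' e; exists h'; exact: e. Qed.

Lemma val_phi P : val (phi P) = if val P is Some (x, y) then Some (x ^+ 3 + b, y ^+ 3) else None.
Proof. by []. Qed.

Lemma twist_phi (f : {rmorphism K -> K}) e (he : e ^+ 3 - e + b = f b) P :
  twist he (phi P) = phi (twist he P).
Proof.
apply: val_inj; rewrite val_phi; case: P => [[[x y]|] h] //=.
rewrite !pFrobenius_autE rmorphD !rmorphXn -he; congr (Some (_, _)).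
by combine ((- f x * e * (f x + e)) *e three0).
Qed.

Lemma phi_inj : injective phi. Proof. exact: twist_inj. Qed.

(** The line through (x - 1, y) and (x + 1, - y) has slope - y. *)
Lemma phiE P : phi P = zeta (zeta P) - zeta P.
Proof.
case: (ptP P) => [|x y h]; first by rewrite !raddf0 addr0.
have [h1 ->] := zeta_affine h.
have [h2 ->] := zeta_affine h1.
have [h3 ->] := phi_affine h.
have [h4 ->] := opp_affine_pt h1.
have c : chord (- y) (x + 1 + 1, y) (x + 1, - y).
  split=> /=; first by combine (- y *e three0).
  by ring.
have [h5 ->] := add_affine_pt h2 h4 c.
apply: eq_affine_pt => /=; first rewrite sqrrN h; last by ring.
by combine ((x + 1) *e three0).
Qed.

Lemma zeta_zeta P : zeta (zeta P) = - P - zeta P.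
Proof. by apply/eqP; rewrite -subr_eq0 opprB opprK addrC [zeta P + P]addrC sum_zeta. Qed.

Lemma zeta3 P : zeta (zeta (zeta P)) = P.
Proof. by rewrite zeta_zeta (zeta_zeta P) opprB opprK addKr. Qed.

(** (zeta^2 - zeta)^2 = -3 as 1 + zeta + zeta^2 = 0. *)
Lemma phi_phi P : phi (phi P) = - (P *+ 3).
Proof.
have zphi Q : zeta (phi Q) = Q - zeta (zeta Q) by rewrite phiE raddfB /= zeta3.
rewrite (phiE (phi P)) zphi raddfB /= zeta3 opprB addrACA [zeta P + _]addrC.
by rewrite zeta_zeta addrNK mulrS mulr2n !opprD.
Qed.

Definition is_cube (z : K) := exists w, z = w ^+ 3.

Definition ycoord (P : as_point) : K := if val P is Some (x, y) then y else 0.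

(** By collinearity: y1 + y2 + y3 is the cube of a slope. *)
Lemma ycoordD P Q : is_cube (ycoord (P + Q) - ycoord P - ycoord Q).
Proof.
case: (ptP P) => [|x y h]; first by exists 0; rewrite add0r /ycoord /=; ring.
case: (ptP Q) => [|x' y' h']; first by exists 0; rewrite addr0 /ycoord /=; ring.
have [[ex ey]|[l c]] := opp_or_chord three0
  (h : on_as_curve b (x, y)) (h' : on_as_curve b (x', y')).
  exists 0; subst x' y'; have [n1 e1] := opp_affine_pt h.
  by rewrite (eq_affine_pt h' n1) // -e1 subrr /ycoord e1 /=; ring.
have [s ->] := add_affine_pt h h' c.
by exists (- l); rewrite /ycoord /=; ring.
Qed.

Lemma cubeD u v : is_cube u -> is_cube v -> is_cube (u + v).
Proof.
move=> [c ->] [d ->]; exists (c + d); combine (- (c * d * (c + d)) *e three0).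
Qed.

Lemma cubeN u : is_cube u -> is_cube (- u).
Proof. by move=> [c ->]; exists (- c); ring. Qed.

Lemma ycoordN P : ycoord (- P) = - ycoord P.
Proof.
case: (ptP P) => [|x y h]; first by rewrite oppr0 /ycoord /= oppr0.
by have [h' ->] := opp_affine_pt h.
Qed.

Lemma ycoordMn P n : is_cube (ycoord (P *+ n) - ycoord P *+ n).
Proof.
elim: n => [|n IH]; first by exists 0; rewrite !mulr0n /ycoord /=; ring.
rewrite !mulrS; have := cubeD (ycoordD P (P *+ n)) IH.
by congr is_cube; ring.
Qed.

(** If y = w^3 then x - b = x^3 - w^6 = (x - w^2)^3. *)
Lemma phi_descent P : is_cube (ycoord P) -> exists Q, P = phi Q.
Proof.
case: (ptP P) => [_|x y h [w]]; first by exists 0; rewrite raddf0.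
rewrite /ycoord /= => ey; have ex : x - b = (x - w ^+ 2) ^+ 3.
  have h' := h; rewrite ey in h'.
  by combine (1 *e h' +e (x * w ^+ 2 * (x - w ^+ 2)) *e three0).
have h' : w ^+ 2 = (x - w ^+ 2) ^+ 3 - (x - w ^+ 2) + b.
  by rewrite -ex; ring.
exists (affine_pt h'); have [h'' ->] := phi_affine h'.
by apply: eq_affine_pt => //; rewrite -ex subrK.
Qed.

(** Multiplication by 3 is injective, being - phi^2, and for n prime to 3 the y-coordinate of
    n P is n y up to a cube. *)
Lemma noncube_torsionfree P n : ~ is_cube (ycoord P) -> P *+ n = 0 -> n = 0%N.
Proof.
move=> ncP; have [N leN] := ubnP n; elim: N n leN => // N IH n leN Pn0.
have [/dvdnP[k ek]|n3] := boolP (3 %| n)%N.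
  suff k0 : k = 0%N by rewrite ek k0.
  have [-> //|k_gt0] := posnP k; apply: IH; first by rewrite ek in leN; lia.
  by apply: phi_inj; apply: phi_inj; rewrite phi_phi -mulrnA -ek Pn0 !raddf0.
case: ncP; have := cubeN (ycoordMn P n); rewrite Pn0 /ycoord /= -/(ycoord P).
rewrite sub0r opprK (divn_eq n 3) mulrnDr mulrnA -[_ *+ 3]mulr_natr three0 mulr0 add0r.
move: n3; rewrite /dvdn; case: (n %% 3)%N (ltn_pmod n (isT : 0 < 3)%N) => [|[|[|]]] //.
move=> _ _ /cubeN; congr is_cube; rewrite -mulr_natr.
  by combine (- ycoord P *e three0).
Qed.

(** Multiply by the conjugate of m + n zeta to reduce to its norm, which vanishes only for
    m = n = 0. *)
Lemma noncube_Zzeta_free P (m n : int) : ~ is_cube (ycoord P) ->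
  P *~ m + zeta P *~ n = 0 -> m = 0 /\ n = 0.
Proof.
move=> ncP e0; set N := m ^+ 2 - m * n + n ^+ 2.
(* N is the norm of m + n zeta, whose conjugate is (m - n) - n zeta. *)
have eN : P *~ N = 0.
  have ez : zeta (P *~ m + zeta P *~ n) = P *~ (- n) + zeta P *~ (m - n).
    rewrite raddfD /= !raddfMz /= zeta_zeta mulrNz mulrzBl mulNrz mulrzBr.
    by rewrite addrCA addrA.
  have : (P *~ m + zeta P *~ n) *~ (m - n) - zeta (P *~ m + zeta P *~ n) *~ n = 0.
    by rewrite e0 raddf0 !mul0rz subr0.
  rewrite ez !mulrzDl -!mulrzA opprD addrACA -!mulrNz -!mulrzDr.
  have -> : n * (m - n) + - ((m - n) * n) = 0 by ring.
  rewrite mulr0z addr0 => <-; congr (_ *~ _); rewrite /N; ring.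
have N0 : N = 0.
  case: N eN => k; first by move=> /(noncube_torsionfree ncP) ->.
  by rewrite NegzE mulrNz => /eqP; rewrite oppr_eq0 => /eqP /(noncube_torsionfree ncP).
have [n0|n0] := eqVneq n 0.
  by split=> //; apply/eqP; rewrite -sqrf_eq0 -N0 /N n0; apply/eqP; ring.
have : 0 < 4 * N.
  have -> : 4 * N = (2 * m - n) ^+ 2 + 3 * n ^+ 2 by rewrite /N; ring.
  by rewrite ltr_wpDl ?sqr_ge0 // pmulr_rgt0 // exprn_even_gt0.
by rewrite N0 mulr0 ltxx.
Qed.

End PointGroup.

(** * Morphisms out of a fraction field *)

Section FractionMorphism.
Import FracField.
Variable R : idomainType.
Local Open Scope quotient_scope.

Lemma frac_numden (x : {fraction R}) : x = (\n_(repr x))%:F / (\d_(repr x))%:F.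
Proof.
have d0 : \d_(repr x) != 0 by apply: denom_ratioP.
apply: (canRL (mulfK _)); first by rewrite tofrac_eq0.
rewrite -{1}[x]reprK; set r := repr x in d0 *.
unlock tofrac; rewrite -[LHS]pi_mul; apply/eqmodP.
by rewrite /= equivfE /mulf /= !numden_Ratio ?(oner_neq0, mul1r, mulr1) // mulrC.
Qed.

Lemma fracP (x : {fraction R}) : exists n d, d != 0 /\ x = n%:F / d%:F.
Proof. by exists \n_(repr x), \d_(repr x); split; [apply: denom_ratioP|apply: frac_numden]. Qed.

Variables (L : fieldType) (f : {rmorphism R -> L}).
Hypothesis f_inj : injective f.

(** The proof of injectivity is an argument so that the morphism structure below can be
    inferred from the term. *)
Definition frac_lift of injective f := fun x : {fraction R} => f (\n_(repr x)) / f (\d_(repr x)).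

Lemma frac_lift_div n d : d != 0 -> frac_lift f_inj (n%:F / d%:F) = f n / f d.
Proof.
move=> d0; have fd0 e : e != 0 -> f e != 0 by rewrite -(inj_eq f_inj) rmorph0.
set x := _ / _; have := frac_numden x; rewrite /frac_lift.
have d'0 : \d_(repr x) != 0 by apply: denom_ratioP.
move: \n_(repr x) (\d_(repr x)) d'0 => n' d' d'0.
move/eqP; rewrite eqr_div ?tofrac_eq0 // -!rmorphM /= tofrac_eq => /eqP e.
by apply/eqP; rewrite eqr_div ?fd0 // -!rmorphM e.
Qed.

Lemma frac_lift_is_zmod_morphism : zmod_morphism (frac_lift f_inj).
Proof.
have fd0 e : e != 0 -> f e != 0 by rewrite -(inj_eq f_inj) rmorph0.
move=> x y; have ex := frac_numden x; have ey := frac_numden y.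
have d0 : \d_(repr x) != 0 by apply: denom_ratioP.
have d'0 : \d_(repr y) != 0 by apply: denom_ratioP.
move: \n_(repr x) (\d_(repr x)) d0 \n_(repr y) (\d_(repr y)) d'0 ex ey => n d d0 n' d' d'0 -> ->.
have -> : n%:F / d%:F - n'%:F / d'%:F = (n * d' - n' * d)%:F / (d * d')%:F :> {fraction R}.
  by rewrite -mulNr tofracB !tofracM -mulNr -addf_div ?tofrac_eq0.
rewrite !frac_lift_div ?mulf_neq0 // rmorphB !rmorphM -!mulNr.
by rewrite addf_div ?fd0.
Qed.

Lemma frac_lift_is_monoid_morphism : monoid_morphism (frac_lift f_inj).
Proof.
have fd0 e : e != 0 -> f e != 0 by rewrite -(inj_eq f_inj) rmorph0.
split.
  have -> : 1 = 1%:F / 1%:F :> {fraction R} by rewrite tofrac1 divr1.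
  by rewrite frac_lift_div ?oner_neq0 // rmorph1 divr1.
move=> x y; have ex := frac_numden x; have ey := frac_numden y.
have d0 : \d_(repr x) != 0 by apply: denom_ratioP.
have d'0 : \d_(repr y) != 0 by apply: denom_ratioP.
move: \n_(repr x) (\d_(repr x)) d0 \n_(repr y) (\d_(repr y)) d'0 ex ey => n d d0 n' d' d'0 -> ->.
by rewrite mulf_div -!tofracM !frac_lift_div ?mulf_neq0 // !rmorphM mulf_div.
Qed.

HB.instance Definition _ :=
  GRing.isZmodMorphism.Build _ _ (frac_lift f_inj) frac_lift_is_zmod_morphism.
HB.instance Definition _ :=
  GRing.isMonoidMorphism.Build _ _ (frac_lift f_inj) frac_lift_is_monoid_morphism.

Lemma frac_lift_tofrac p : frac_lift f_inj p%:F = f p.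
Proof. by rewrite -[p%:F]divr1 -tofrac1 frac_lift_div ?oner_neq0 // rmorph1 divr1. Qed.

End FractionMorphism.

(** * Reduced coordinates *)

Section Reduced.
Variable F : fieldType.
Implicit Types p q : {poly F}.

Lemma frac_reduced (x : {fraction {poly F}}) :
  exists p q, [/\ q \is monic, coprimep p q & x = p%:F / q%:F].
Proof.
have [n [d [d0 ->]]] := fracP x.
set g := gcdp n d.
have g0 : g != 0 by rewrite gcdp_eq0 negb_and d0 orbT.
have dE : d = d %/ g * g by rewrite divpK ?dvdp_gcdr.
have nE : n = n %/ g * g by rewrite divpK ?dvdp_gcdl.
have q0 : d %/ g != 0 by apply: contraNneq d0 => q0; rewrite dE q0 mul0r.
have c0 : (lead_coef (d %/ g))^-1 != 0 by rewrite invr_eq0 lead_coef_eq0.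
exists ((lead_coef (d %/ g))^-1 *: (n %/ g)), ((lead_coef (d %/ g))^-1 *: (d %/ g)); split.
- by rewrite monicE lead_coefZ mulVf // lead_coef_eq0.
- by rewrite coprimepZl // coprimepZr // coprimep_div_gcd // d0 orbT.
apply/eqP; rewrite eqr_div ?tofrac_eq0 ?scaler_eq0 ?negb_or ?c0 // -!tofracM tofrac_eq.
rewrite -scalerAl -scalerAr; apply/eqP; congr (_ *: _).
by rewrite {1}nE [in RHS]dE mulrAC mulrA.
Qed.

(** Kept for an arbitrary field: polynomial identities are only proved for abstract
    variables, and then specialised to fractions of polynomials. *)
Lemma clear_denominators (K : fieldType) (X W Y Z B : K) : W != 0 -> Z != 0 ->
  (Y / Z) ^+ 2 = (X / W) ^+ 3 - X / W + B ->
  Y ^+ 2 * W ^+ 3 = Z ^+ 2 * (X ^+ 3 - X * W ^+ 2 + B * W ^+ 3).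
Proof.
move=> W0 Z0 e; have -> : Y ^+ 2 * W ^+ 3 = (Y / Z) ^+ 2 * (Z ^+ 2 * W ^+ 3) by field; rewrite Z0.
by rewrite e; field; rewrite W0.
Qed.

(** The shape of a point (X / D^2, Y / D^3) in lowest terms on y^2 = x^3 - x + B. *)
Definition reduced_on (B X Y D : {poly F}) : Prop :=
  [/\ D \is monic, coprimep X D, coprimep Y D &
      Y ^+ 2 = X ^+ 3 - X * D ^+ 4 + B * D ^+ 6].

Lemma monic_dvdp_eq p q : p \is monic -> q \is monic -> p %| q -> q %| p -> p = q.
Proof.
by move=> pm qm pq qp; apply/eqP; rewrite -eqp_monic // /eqp pq qp.
Qed.

(** Comparing the denominators W of x and Z of y gives W^3 = Z^2, so W is a square. *)
Lemma point_reduced (B : {poly F}) (x y : {fraction {poly F}}) :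
    y ^+ 2 = x ^+ 3 - x + B%:F ->
  exists X Y D, [/\ reduced_on B X Y D, x = X%:F / (D ^+ 2)%:F & y = Y%:F / (D ^+ 3)%:F].
Proof.
have [X [W [Wm cXW ->]]] := frac_reduced x; have [Y [Z [Zm cYZ ->]]] := frac_reduced y.
have W0 := monic_neq0 Wm; have Z0 := monic_neq0 Zm.
move/clear_denominators; rewrite !tofrac_eq0 W0 Z0 => /(_ isT isT) /eqP.
rewrite -!(tofracXn, tofracM, tofracB, tofracD) tofrac_eq => /eqP e.
set N := X ^+ 3 - _ + _ in e.
have cNW : coprimep N W.
  have -> : N = X ^+ 3 + W * (B * W ^+ 2 - X * W) by rewrite /N; ring.
  by rewrite coprimep_sym addrC mulrC coprimep_addl_mul coprimep_expr // coprimep_sym.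
(* The equation reads Y^2 W^3 = Z^2 N with Y prime to Z and N prime to W. *)
have e1 : W ^+ 3 = Z ^+ 2.
  apply: monic_dvdp_eq; rewrite ?monic_exp //.
    have : W ^+ 3 %| Z ^+ 2 * N by rewrite -e dvdp_mulIr.
    by rewrite Gauss_dvdpl // coprimep_expl // coprimep_sym.
  have : Z ^+ 2 %| Y ^+ 2 * W ^+ 3 by rewrite e dvdp_mulIl.
  by rewrite Gauss_dvdpr // coprimep_expl // coprimep_expr // coprimep_sym.
have /dvdpP[D eZ] : W %| Z.
  by rewrite -(@dvdp_pexp2r _ W Z 2) // -e1 [W ^+ 3]exprS dvdp_mulIr.
have eW : W = D ^+ 2.
  apply: (mulIf (expf_neq0 2 W0)); rewrite -exprS e1 eZ; ring.
have eZ' : Z = D ^+ 3 by rewrite eZ eW; ring.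
have Dm : D \is monic.
  have D0 : D != 0 by apply: contraNneq Z0 => D0; rewrite eZ D0 mul0r.
  by move: Zm; rewrite eZ monicMr.
exists X, Y, D; split; rewrite -?eW -?eZ' //; split=> //.
- by move: cXW; rewrite eW coprimep_pexpr.
- by move: cYZ; rewrite eZ' coprimep_pexpr.
apply: (mulIf (expf_neq0 6 (monic_neq0 Dm))).
move: e; rewrite /N eW eZ' => e.
have -> : Y ^+ 2 * D ^+ 6 = Y ^+ 2 * D ^+ 2 ^+ 3 by ring.
rewrite e; ring.
Qed.
End Reduced.

(** * Cubes in characteristic 3 *)

Lemma expr3n_additive (R : comNzRingType) (h : 3 = 0 :> R) n (x y : R) :
  (x + y) ^+ (3 ^ n) = x ^+ (3 ^ n) + y ^+ (3 ^ n).
Proof. by apply: exprDn_pchar; rewrite pnatX pnatE // inE /= h eqxx. Qed.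

Section CubeRoot.
Variables (F : finFieldType) (three0 : 3 = 0 :> F).

Lemma poly_three0 : 3 = 0 :> {poly F}.
Proof. by rewrite -polyC_natr three0 polyC0. Qed.

Lemma poly_cubeD (p q : {poly F}) : (p + q) ^+ 3 = p ^+ 3 + q ^+ 3.
Proof. by have := expr3n_additive poly_three0 1 p q; rewrite expn1. Qed.

Lemma cube_root_exists (x : F) : exists y, y ^+ 3 = x.
Proof.
have inj : injective (fun y : F => y ^+ 3).
  move=> y z /eqP; rewrite -subr_eq0 => h; apply/eqP; rewrite -subr_eq0.
  have := expr3n_additive three0 1 (y - z) z; rewrite subrK expn1 => e.
  by move: h; rewrite e addrK expf_eq0.
have [g _ gK] := injF_bij inj.
by exists (g x).
Qed.

(** Only exponents divisible by 3 occur, and F is perfect. *)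
Lemma deriv0_cube (p : {poly F}) : p^`() = 0 -> exists r, p = r ^+ 3.
Proof.
move=> p'0.
have coef0 j : ~~ (3 %| j)%N -> p`_j = 0.
  case: j => [|j] // nj; have := congr1 (fun r : {poly F} => r`_j) p'0.
  rewrite coef_deriv coef0 -mulr_natr => /eqP; rewrite mulf_eq0 => /orP[/eqP //|].
  have -> : (j.+1%:R == 0 :> F) = (3 %| j.+1)%N.
    by rewrite -(dvdn_pcharf (p := 3)) // inE /= three0 eqxx.
  by rewrite (negbTE nj).
have [g gK] : exists g : F -> F, forall x, g x ^+ 3 = x.
  by apply: (fin_all_exists cube_root_exists).
(* The exponents k < size p overshoot: the coefficients beyond size p vanish. *)
set n := size p; exists (\sum_(k < n) g p`_(3 * k) *: 'X^k).
have -> : (\sum_(k < n) g p`_(3 * k) *: 'X^k) ^+ 3 = \sum_(k < n) (g p`_(3 * k) *: 'X^k) ^+ 3.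
  elim/big_rec2: _ => [|k v u _ <-]; first by rewrite expr0n /=.
  exact: poly_cubeD.
apply/polyP => j; rewrite coef_sum.
have E k : ((g p`_(3 * k) *: 'X^k) ^+ 3)`_j = p`_(3 * k) * (j == 3 * k)%:R.
  by rewrite exprZn gK -exprM coefZ coefXn [(k * 3)%N]mulnC.
under eq_bigr do rewrite E.
have [/dvdnP[k ek]|nj] := boolP (3 %| j)%N; last first.
  rewrite coef0 // big1 // => k _; have [ej|_] := eqVneq j (3 * k)%N; last by rewrite mulr0.
  by rewrite ej dvdn_mulr in nj.
have [lkn|lenk] := ltnP k n.
  rewrite (bigD1 (Ordinal lkn)) //= ek mulnC eqxx mulr1 big1 ?addr0 // => l nl.
  rewrite eqn_pmul2l //; have [e|_] := eqVneq k l; last by rewrite mulr0.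
  by case/eqP: nl; apply: val_inj.
rewrite nth_default; last by rewrite ek -/n; lia.
rewrite big1 // => l _; have [e|_] := eqVneq j (3 * l)%N; last by rewrite mulr0.
by have := ltn_ord l; lia.
Qed.
End CubeRoot.

(** * The subfield with s elements and its translations *)

(** The substitution t -> t + w. *)
Definition poly_shift (R : nzRingType) (w : R) (p : {poly R}) := p \Po ('X + w%:P).

Section Invariance.
Variables (F : finFieldType) (three0 : 3 = 0 :> F) (m : nat).
Local Notation s := (3 ^ m)%N.

Definition frob_sub_id : {poly F} := 'X^s - 'X.
Local Notation T := frob_sub_id.
Definition in_subfield (w : F) : bool := w ^+ s == w.
Local Notation Fs := in_subfield.

Hypothesis m_gt0 : (0 < m)%N.

Lemma pow3_gt2 : (2 < s)%N.
Proof. by case: m m_gt0 => // k _; rewrite expnS; have := expn_gt0 3 k; lia. Qed.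

Lemma size_frob_sub_id : size T = s.+1.
Proof.
rewrite /frob_sub_id size_polyDl size_polyXn // size_polyN size_polyX.
by have := pow3_gt2; lia.
Qed.

Lemma frob_sub_id_monic : T \is monic.
Proof.
rewrite monicE /frob_sub_id lead_coefDl ?lead_coefXn //.
by rewrite size_polyXn size_polyN size_polyX; have := pow3_gt2; lia.
Qed.

Lemma pow3_add (x y : F) : (x + y) ^+ s = x ^+ s + y ^+ s.
Proof. exact: expr3n_additive. Qed.

Lemma pow3_poly_add (p q : {poly F}) : (p + q) ^+ s = p ^+ s + q ^+ s.
Proof. exact/expr3n_additive/poly_three0. Qed.

Lemma pow3_opp (R : comNzRingType) (x : R) : (- x) ^+ s = - x ^+ s.
Proof. by rewrite exprNn -signr_odd oddX orbT expr1 mulN1r. Qed.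

Lemma root_frob_sub_id w : root T w = Fs w.
Proof. by rewrite rootE /frob_sub_id !hornerE subr_eq0. Qed.

Hypothesis cardF : #|F| = (s ^ 2)%N.

Lemma card_in_subfield : #|[pred w | Fs w]| = s.
Proof.
have Fs_le : (#|[pred w | Fs w]| <= s)%N.
  rewrite cardE -ltnS -size_frob_sub_id.
  apply: max_poly_roots; rewrite ?enum_uniq ?monic_neq0 ?frob_sub_id_monic //.
  by apply/allP => w; rewrite mem_enum inE root_frob_sub_id.
(* 'X^q - 'X = T^s + T = T * g, so every element of F outside F_s is a root of g. *)
pose g := T ^+ s.-1 + 1.
have s1 : (0 < s.-1)%N by have := pow3_gt2; lia.
have sizeT' : size (T ^+ s.-1) = (s * s.-1).+1.
  have := size_exp T s.-1; rewrite size_frob_sub_id /= => <-.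
  by rewrite prednK // size_poly_gt0 monic_neq0 ?monic_exp ?frob_sub_id_monic.
have size_g : size g = (s * s.-1).+1.
  by rewrite /g size_polyDl ?sizeT' // size_poly1 ltnS muln_gt0 s1 expn_gt0.
have g0 : g != 0 by rewrite -size_poly_gt0 size_g.
have Fs'_le : (#|[pred w | ~~ Fs w]| <= s * s.-1)%N.
  rewrite cardE -ltnS -size_g; apply: max_poly_roots; rewrite ?enum_uniq //.
  apply/allP => w; rewrite mem_enum inE /= -root_frob_sub_id rootE => nTw.
  rewrite rootE /g hornerD hornerC horner_exp; apply/eqP/(mulfI nTw).
  rewrite mulr0 mulrDr mulr1 -exprS prednK; last by have := pow3_gt2; lia.
  rewrite /frob_sub_id !hornerE pow3_add pow3_opp -exprM -[(s * s)%N]/(s ^ 2)%N -cardF expf_card.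
  by rewrite /= subrK subrr.
have s2 : (s ^ 2 = s + s * s.-1)%N.
  by rewrite -mulnS prednK ?expnS ?expn0 ?muln1 //; have := pow3_gt2; lia.
apply/eqP; rewrite eqn_leq Fs_le /= -(leq_add2r (s * s.-1)) -s2 -cardF.
by rewrite -(cardC [pred w | Fs w]) leq_add2l.
Qed.

Lemma in_subfield_add u v : Fs u -> Fs v -> Fs (u + v).
Proof. by move=> /eqP hu /eqP hv; rewrite /Fs pow3_add hu hv. Qed.
Lemma in_subfield_opp u : Fs u -> Fs (- u).
Proof. by move=> /eqP hu; rewrite /Fs pow3_opp hu. Qed.
Lemma in_subfield_mul u v : Fs u -> Fs v -> Fs (u * v).
Proof. by move=> /eqP hu /eqP hv; rewrite /Fs exprMn hu hv. Qed.
Lemma in_subfield_inv u : Fs u -> Fs u^-1.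
Proof. by move=> /eqP hu; rewrite /Fs exprVn hu. Qed.

Lemma poly_shift_frob_sub_id w : Fs w -> poly_shift w T = T.
Proof.
move=> /eqP hw; rewrite /poly_shift /frob_sub_id rmorphB rmorphXn /= comp_polyX.
rewrite pow3_poly_add -polyC_exp hw.
by rewrite opprD addrACA subrr addr0.
Qed.

Definition shift_invariant (p : {poly F}) := forall w, Fs w -> poly_shift w p = p.

Lemma frob_sub_id_prod : T = \prod_(w <- enum [pred w | Fs w]) ('X - w%:P).
Proof.
rewrite (@all_roots_prod_XsubC _ T (enum [pred w | Fs w])).
- by rewrite (monicP frob_sub_id_monic) scale1r.
- by rewrite size_frob_sub_id -cardE card_in_subfield.
- by apply/allP => w; rewrite mem_enum inE /= root_frob_sub_id.
by rewrite uniq_rootsE enum_uniq.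
Qed.

(** Such a polynomial is a polynomial in T: p - p(0) vanishes on F_s, hence is divisible by
    T, and the quotient is invariant of smaller degree. *)
Lemma invariant_degree p : shift_invariant p -> (s %| (size p).-1)%N.
Proof.
have [N leN] := ubnP (size p); elim: N p leN => // N IH p leN ip.
have [p1|p1] := leqP (size p) 1; first by case: (size p) p1 => [|[|]].
pose c := p.[0].
have size_pc : size (p - c%:P) = size p.
  by rewrite size_polyDl // size_polyN; apply: leq_ltn_trans p1; apply: size_polyC_leq1.
have /dvdpP[q eq] : T %| p - c%:P.
  rewrite frob_sub_id_prod; apply: uniq_roots_dvdp; last by rewrite uniq_rootsE enum_uniq.
  apply/allP => w; rewrite mem_enum inE /= => hw; have cE : c = p.[w].
    by rewrite /c -{1}(ip _ hw) /poly_shift horner_comp !hornerE.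
  by rewrite rootE !hornerE cE subrr.
have q0 : q != 0.
  by apply: contraTneq p1 => q0; rewrite -size_pc eq q0 mul0r size_poly0.
have iq : shift_invariant q.
  move=> w hw; apply: (mulIf (monic_neq0 frob_sub_id_monic)).
  rewrite -{1}(poly_shift_frob_sub_id hw) /poly_shift -rmorphM -eq rmorphB /=.
  by rewrite comp_polyC -/(poly_shift w p) ip.
have := size_pc; rewrite eq size_mul ?q0 ?(monic_neq0 frob_sub_id_monic) //.
rewrite size_frob_sub_id addnS /= => e.
have sq : (0 < size q)%N by rewrite size_poly_gt0.
have -> : ((size p).-1 = (size q).-1 + s)%N by rewrite -e -(prednK sq) addSn.
rewrite dvdn_addl //; apply: IH iq; apply: leq_trans (_ : size p <= N)%N; last by [].
by rewrite -e -addn1 leq_add2l expn_gt0.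
Qed.

End Invariance.

(** * The derivative of y *)

Section Derivative.
Variables (F : finFieldType) (three0 : 3 = 0 :> F) (m : nat) (m_gt0 : (0 < m)%N).
Local Notation s := (3 ^ m)%N.
Local Notation T := (frob_sub_id F m).
Variables (d : F) (d4 : d ^+ 4 = -1).

(** The y-coordinate of a point with x = 0; the curve has b = A^2. *)
Definition y0poly : {poly F} := d *: T.
Local Notation A := y0poly.
Local Notation B := (A ^+ 2).

Lemma d_neq0 : d != 0.
Proof.
apply/eqP => d0; have /eqP := oner_neq0 F; apply; apply: oppr_inj.
by rewrite -d4 d0 expr0n oppr0.
Qed.

Lemma deriv_y0poly : A^`() = - d%:P.
Proof.
rewrite /y0poly derivZ derivB derivXn derivX -mulr_natr.
have -> : s%:R = 0 :> {poly F}.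
  by case: (m) m_gt0 => // k _; rewrite expnS natrM (poly_three0 three0) mul0r.
by rewrite mulr0 sub0r scalerN alg_polyC.
Qed.

(** Differentiate the equation, using 3 = 0 and A' = - d. *)
Lemma deriv_curve (X Y D : {poly F}) : Y ^+ 2 = X ^+ 3 - X * D ^+ 4 + B * D ^+ 6 ->
  Y * Y^`() = D ^+ 3 * ((X * D)^`() - d%:P * A * D ^+ 3).
Proof.
have t0 := poly_three0 three0.
move=> /(congr1 deriv); rewrite !exprS !expr0 !mulr1 !(derivD, derivN, derivM) deriv_y0poly => h.
by combine (2 *e h +e (- Y * Y^`() + 2 * X ^+ 2 * X^`() - X^`() * D ^+ 4
  - 3 * X * D ^+ 3 * D^`() - d%:P * A * D ^+ 6 + 4 * A ^+ 2 * D ^+ 5 * D^`()) *e t0).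
Qed.

Lemma size_mulS (p q : {poly F}) : p != 0 -> q != 0 ->
  size (p * q) = ((size p).-1 + (size q).-1).+1.
Proof.
move=> p0 q0; have -> : size (p * q) = (size p + size q).-1 by exact: size_mul.
have : (0 < size p)%N by rewrite size_poly_gt0.
have : (0 < size q)%N by rewrite size_poly_gt0.
by lia.
Qed.

Lemma size_expS (p : {poly F}) n : p != 0 -> size (p ^+ n) = ((size p).-1 * n).+1.
Proof.
by move=> p0; have <- := size_exp p n; rewrite prednK // size_poly_gt0 expf_neq0.
Qed.

Lemma size_y0poly : size A = s.+1.
Proof. by rewrite /y0poly size_scale ?d_neq0 // size_frob_sub_id. Qed.

Lemma lead_coef_y0poly : lead_coef A = d.
Proof. by rewrite /y0poly lead_coefZ (monicP (frob_sub_id_monic F m_gt0)) mulr1. Qed.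

Lemma y0poly_neq0 : A != 0.
Proof. by rewrite -size_poly_gt0 size_y0poly. Qed.

(** As (Y / D^3)' = Y' / D^3, the conclusion says that the derivative of y is 0, d or - d.
    Since D is prime to Y, [deriv_curve] gives Y' = D^3 f with a polynomial f such that
    Y f = (X D)' - d A D^3. If deg X is large then f = 0 by degree. Otherwise d A D^3 is the
    leading part of the right-hand side and A^2 D^6 that of Y^2, which makes f a constant
    with f^2 = d^2. In the intermediate case deg X^3 = deg A^2 D^6 the terms could cancel; it
    is excluded because s divides deg X and deg D. *)
Lemma deriv_reduced (X Y D : {poly F}) : reduced_on B X Y D ->
    (s %| (size X).-1)%N -> (s %| (size D).-1)%N ->
  exists2 c : F, c \in [:: 0; d; - d] & Y^`() = c *: D ^+ 3.
Proof.
move=> [Dm cXD cYD e] sX sD.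
have D0 := monic_neq0 Dm.
have [Y0|Y0] := eqVneq Y 0.
  by exists 0; [rewrite inE eqxx|rewrite Y0 linear0 scale0r].
have [f ef] : exists f : {poly F}, Y^`() = D ^+ 3 * f.
  suff /dvdpP[f ef] : D ^+ 3 %| Y^`() by exists f; rewrite ef mulrC.
  have : D ^+ 3 %| Y * Y^`() by rewrite (deriv_curve e) dvdp_mulIl.
  by rewrite Gauss_dvdpr // coprimep_expl // coprimep_sym.
have eYf : Y * f = (X * D)^`() - d%:P * A * D ^+ 3.
  apply: (mulfI (expf_neq0 3 D0)); rewrite -(deriv_curve e) ef; ring.
have sizeD3 : size (d%:P * A * D ^+ 3) = (3 * (size D).-1 + s).+1.
  rewrite mul_polyC -scalerAl size_scale ?d_neq0 // size_mulS ?y0poly_neq0 ?expf_neq0 //.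
  by rewrite size_y0poly size_expS //=; lia.
have sizeB : size (B * D ^+ 6) = (2 * s + 6 * (size D).-1).+1.
  by rewrite size_mulS ?expf_neq0 ?y0poly_neq0 // !size_expS ?y0poly_neq0 // size_y0poly /=; lia.
have sizeXD : (size (X * D)^`() <= (size X).-1 + (size D).-1)%N.
  have [->|X0] := eqVneq X 0; first by rewrite mul0r linear0 size_poly0.
  have XD0 : X * D != 0 by rewrite mulf_neq0.
  by rewrite -ltnS -size_mulS // lt_size_deriv.
have sY : (0 < size Y)%N by rewrite size_poly_gt0.
have s_gt0 : (0 < s)%N by rewrite expn_gt0.
have sizeRHS : (size (Y * f)%R <= maxn (size (X * D)^`() ) (3 * (size D).-1 + s).+1)%N.
  by rewrite eYf -sizeD3 -(size_polyN (_ * D ^+ 3)) size_polyD.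
have sizeY2 : size (Y ^+ 2) = (2 * (size Y).-1).+1 by rewrite size_expS // mulnC.
(* If X^3 dominates Y^2 then Y is too large for Y f unless f = 0. *)
have [lt3|le3] := ltnP (2 * s + 6 * (size D).-1) (3 * (size X).-1).
  have X0 : X != 0 by rewrite -size_poly_gt0; case: (size X) lt3.
  have sizeX3 : size (X ^+ 3) = (3 * (size X).-1).+1 by rewrite size_expS // mulnC.
  have sizeXD4 : size (X * D ^+ 4) = ((size X).-1 + 4 * (size D).-1).+1.
    by rewrite size_mulS ?expf_neq0 // size_expS //= mulnC.
  have sizeY : (2 * (size Y).-1 = 3 * (size X).-1)%N.
    apply/succn_inj; rewrite -sizeY2 e -sizeX3 -addrA size_polyDl //.
    apply: leq_ltn_trans (size_polyD _ _) _.
    by rewrite gtn_max size_polyN sizeXD4 sizeB sizeX3; lia.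
  have [f0|f0] := eqVneq f 0; first by exists 0; [rewrite inE eqxx|rewrite ef f0 mulr0 scale0r].
  exfalso; move: sizeRHS; rewrite leq_max size_mulS // => h.
  have {}h : (size Y <= (size X).-1 + (size D).-1)%N || (size Y <= (3 * (size D).-1 + s).+1)%N.
    case/orP: h => h; apply/orP; [left|right]; last by clear -h sY; lia.
    by clear -h sizeXD sY; lia.
  by clear -h sY lt3 sizeY; move: (size X).-1 (size D).-1 (size Y) s h sY lt3 sizeY; lia.
(* Equality of the two degrees would give 3 x = 2 + 6 y, with s x = deg X and s y = deg D. *)
have lt3 : (3 * (size X).-1 < 2 * s + 6 * (size D).-1)%N.
  rewrite ltn_neqAle le3 andbT; apply/eqP => eq3.
  have /dvdnP[x ex] := sX; have /dvdnP[y ey] := sD; rewrite ex ey in eq3.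
  have : (s * (3 * x) == s * (2 + 6 * y))%N.
    rewrite mulnCA [(s * x)%N]mulnC eq3 mulnDr [(s * 2)%N]mulnC.
    by rewrite [(s * (6 * y))%N]mulnCA [(s * y)%N]mulnC.
  by rewrite eqn_pmul2l // => /eqP; lia.
have sizeN : (size (X ^+ 3 - X * D ^+ 4)%R < size (B * D ^+ 6)%R)%N.
  apply: leq_ltn_trans (size_polyD _ _) _; rewrite gtn_max size_polyN sizeB.
  have [->|X0] := eqVneq X 0; first by rewrite expr0n mul0r size_poly0.
  rewrite (size_expS 3 X0) (size_mulS X0 (expf_neq0 4 D0)) (size_expS 4 D0) /=.
  move: lt3; move: (size X).-1 (size D).-1 s => n k l lt3.
  by clear -lt3; apply/andP; split; lia.
have sizeY : ((size Y).-1 = s + 3 * (size D).-1)%N.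
  have : size (Y ^+ 2) = size (B * D ^+ 6) by rewrite e addrC size_polyDl.
  by rewrite sizeY2 sizeB; lia.
have leadY : lead_coef Y ^+ 2 = d ^+ 2.
  rewrite -lead_coef_exp e addrC lead_coefDl // lead_coefM !lead_coef_exp.
  by rewrite lead_coef_y0poly (monicP Dm) expr1n mulr1.
have ltXD : (size ((X * D)^`())%R < size (- (d%:P * A * D ^+ 3))%R)%N.
  by rewrite size_polyN sizeD3; lia.
(* Now B D^6 dominates Y^2, so Y f and Y have the same degree and f is a constant. *)
have sizeYf : size (Y * f) = (3 * (size D).-1 + s).+1.
  by rewrite eYf addrC size_polyDl // size_polyN sizeD3.
have f0 : f != 0 by apply: contra_eq_neq sizeYf => ->; rewrite mulr0 size_poly0.
have size_f : size f = 1.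
  have : (0 < size f)%N by rewrite size_poly_gt0.
  by move: sizeYf; rewrite size_mulS //; lia.
have /size_poly1P[c c0 ef'] : size f == 1 by rewrite size_f.
exists c; last by rewrite ef ef' mulrC mul_polyC.
(* With l the leading coefficient of Y: l^2 = d^2 and l c = - d^2. *)
have : lead_coef (Y * f) = - d ^+ 2.
  rewrite eYf addrC lead_coefDl // lead_coefN !lead_coefM lead_coefC.
  by rewrite lead_coef_y0poly (monicP Dm) !mulr1.
rewrite lead_coefM ef' lead_coefC => h.
rewrite !inE -[c == d]subr_eq0 -[c == - d]subr_eq0 opprK -mulf_eq0.
have d20 : d ^+ 2 != 0 by rewrite expf_neq0 ?d_neq0.
apply/orP; right; rewrite -(mulrI_eq0 _ (mulfI d20)); apply/eqP.
transitivity ((lead_coef Y * c) ^+ 2 - (d ^+ 2) ^+ 2); first by rewrite exprMn leadY; ring.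
by rewrite h sqrrN subrr.
Qed.
End Derivative.

(** * The Heisenberg action *)

Section Substitution.
Variable F : fieldType.
Local Notation K := {fraction {poly F}}.

Lemma poly_shift_inj (c : F) : injective (poly_shift c).
Proof.
apply: (can_inj (g := poly_shift (- c))) => p.
rewrite /poly_shift -comp_polyA comp_polyD comp_polyX comp_polyC.
by rewrite -addrA -polyCD addNr addr0 comp_polyXr.
Qed.

Definition tofrac_shift (c : F) : {rmorphism {poly F} -> K} :=
  @tofrac {poly F} \o comp_poly ('X + c%:P).

Lemma tofrac_shift_inj c : injective (tofrac_shift c).
Proof. by move=> p q /eqP; rewrite /= tofrac_eq => /eqP /(@poly_shift_inj c). Qed.

Definition frac_shift (c : F) : {rmorphism K -> K} := frac_lift (@tofrac_shift_inj c).

Lemma frac_shift_tofrac c p : frac_shift c p%:F = (poly_shift c p)%:F.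
Proof. exact: frac_lift_tofrac. Qed.

Lemma frac_shift_div c n e : frac_shift c (n%:F / e%:F) = (poly_shift c n)%:F / (poly_shift c e)%:F.
Proof. by rewrite (fmorph_div (frac_shift c)) !frac_shift_tofrac. Qed.

Lemma poly_shift_add (c1 c2 : F) p : poly_shift c1 (poly_shift c2 p) = poly_shift (c1 + c2) p.
Proof.
by rewrite /poly_shift -comp_polyA comp_polyD comp_polyX comp_polyC -addrA -polyCD.
Qed.

Lemma shiftB (c : F) p q : poly_shift c (p - q) = poly_shift c p - poly_shift c q.
Proof. exact: comp_polyB. Qed.
Lemma shiftXn (c : F) p n : poly_shift c (p ^+ n) = poly_shift c p ^+ n.
Proof. exact: (rmorphXn (comp_poly ('X + c%:P))). Qed.
Lemma shiftX (c : F) : poly_shift c 'X = 'X + c%:P.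
Proof. exact: comp_polyX. Qed.
Lemma shiftZ (c a : F) p : poly_shift c (a *: p) = a *: poly_shift c p.
Proof. exact: comp_polyZ. Qed.

Lemma shift0 (p : {poly F}) : poly_shift 0 p = p.
Proof. by rewrite /poly_shift addr0 comp_polyXr. Qed.

Lemma frac_shift_add c1 c2 x : frac_shift c1 (frac_shift c2 x) = frac_shift (c1 + c2) x.
Proof.
have [n [e [_ ->]]] := fracP x.
by rewrite !frac_shift_div !poly_shift_add.
Qed.

Lemma frac_shift0 x : frac_shift 0 x = x.
Proof. by have [n [e [_ ->]]] := fracP x; rewrite frac_shift_div !shift0. Qed.

Lemma frac_three0 : 3 = 0 :> F -> 3 = 0 :> K.
Proof.
move=> /(congr1 (fun z : F => z%:P%:F)); rewrite polyC0 tofrac0 => <-.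
by rewrite polyC_natr (rmorph_nat (@tofrac {poly F})).
Qed.

End Substitution.

Section Trace.
Variables (R : comNzRingType) (three0 : 3 = 0 :> R) (m : nat).
(** For z with z^(3^m) = z this is the trace to the prime field. *)
Definition tr (z : R) := \sum_(k < m) z ^+ (3 ^ k).

Lemma trD z t : tr (z + t) = tr z + tr t.
Proof. by rewrite /tr -big_split; apply: eq_bigr => k _; apply: expr3n_additive. Qed.

(** A telescoping sum; so tr z solves e^3 - e = z^(3^m) - z. *)
Lemma tr_cube z : tr z ^+ 3 - tr z = z ^+ (3 ^ m) - z.
Proof.
have cubeD (a c : R) : (a + c) ^+ 3 = a ^+ 3 + c ^+ 3.
  by have := expr3n_additive three0 1 a c; rewrite expn1.
rewrite /tr; elim: m => [|k IH]; first by rewrite !big_ord0 expr0n subr0 expr1 subrr.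
rewrite big_ord_recr /= cubeD opprD addrACA IH -exprM -expnSr.
by rewrite addrC addrA subrK.
Qed.
End Trace.

Lemma tr_rmorph (R S : comNzRingType) (f : {rmorphism R -> S}) m z : tr m (f z) = f (tr m z).
Proof. by rewrite /tr rmorph_sum; apply: eq_bigr => k _; rewrite rmorphXn. Qed.

Section Maps.
Variables (F : finFieldType) (three0 : 3 = 0 :> F) (m : nat).
Hypothesis (m_gt0 : (0 < m)%N) (m_odd : odd m).
Local Notation s := (3 ^ m)%N.
Hypothesis cardF : #|F| = (s ^ 2)%N.
Variables (d : F) (d4 : d ^+ 4 = -1).
Local Notation K := {fraction {poly F}}.
Local Notation T := (frob_sub_id F m).
Local Notation A := (y0poly m d).
Local Notation Fs := (@in_subfield F m).
Local Notation three0K := (frac_three0 three0).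
Local Notation b := ((A ^+ 2)%:F).
Definition twisted_points := as_point three0K b.
Local Notation V := twisted_points.
HB.instance Definition _ := GRing.Zmodule.on V.

Definition subfield_elt := {w : F | Fs w}.
Local Notation I := subfield_elt.
HB.instance Definition _ := Finite.on I.

Lemma card_subfield_elt : #|{: I}| = s.
Proof. by rewrite card_sig card_in_subfield. Qed.

Lemma poly_shift_y0poly w : Fs w -> poly_shift w A = A.
Proof. by move=> hw; rewrite /y0poly shiftZ poly_shift_frob_sub_id. Qed.

Lemma translate_eq (w : I) : 0 ^+ 3 - 0 + b = frac_shift (val w) b.
Proof. by rewrite expr0n subr0 add0r frac_shift_tofrac shiftXn poly_shift_y0poly // (valP w). Qed.

Definition translate (w : I) : V -> V := twist (translate_eq w).
HB.instance Definition _ w := GRing.Additive.on (translate w).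

(** With i = d^2, this is Tr(u t - i u^2), chosen to satisfy the next equation. *)
Definition heis_cocycle (u : F) : {poly F} := tr m (u *: 'X - (d ^+ 2 * u ^+ 2)%:P).

(** The place where m must be odd: i = d^2 is a square root of -1, which the m-th power of
    Frobenius maps to - i exactly when m is odd. *)
Lemma d2_pow : (d ^+ 2) ^+ s = - d ^+ 2.
Proof.
have d23 : (d ^+ 2) ^+ 3 = - d ^+ 2 by rewrite -exprM (exprD d 2 4) d4 mulrN1.
have pow k : (d ^+ 2) ^+ (3 ^ k) = (-1) ^+ k * d ^+ 2.
  elim: k => [|k IH]; first by rewrite expr1 mul1r.
  have e : ((-1) ^+ k) ^+ 3 = (-1) ^+ k :> F.
    by rewrite -exprM mulnC exprM; congr (_ ^+ _); ring.
  by rewrite expnSr exprM IH exprMn d23 e [(-1) ^+ k.+1]exprS; ring.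
by rewrite pow -signr_odd m_odd mulN1r.
Qed.

(** T(t + i u) = T + i u because (i u)^s = - i u and -2 = 1. So b changes by
    u T - i u^2, which is z^s - z for z = u t - i u^2, that is B^3 - B for B = Tr z. *)
Lemma heis_cocycle_eq u : Fs u ->
  heis_cocycle u ^+ 3 - heis_cocycle u + A ^+ 2 = poly_shift (d ^+ 2 * u) (A ^+ 2).
Proof.
move=> hu; have t0 := poly_three0 three0.
have cs : (d ^+ 2 * u ^+ 2) ^+ s = - (d ^+ 2 * u ^+ 2).
  by rewrite exprMn d2_pow -[u ^+ 2 ^+ s]exprM mulnC exprM (eqP hu) mulNr.
have vs : (d ^+ 2 * u) ^+ s = - (d ^+ 2 * u) by rewrite exprMn d2_pow (eqP hu) mulNr.
have ps (a : F) : a%:P ^+ s = (a ^+ s)%:P by rewrite polyC_exp.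
rewrite /heis_cocycle (tr_cube t0) (pow3_poly_add three0) pow3_opp.
rewrite -[u *: 'X]mul_polyC exprMn !ps cs (eqP hu).
rewrite shiftXn /y0poly shiftZ /frob_sub_id shiftB shiftXn shiftX (pow3_poly_add three0) ps vs.
rewrite -!mul_polyC !(polyCM, polyCN, polyC_exp).
have e4 : d%:P ^+ 4 = -1 by rewrite -polyC_exp d4 polyCN.
(* Both sides are now polynomials in y = t^s, x = t, w = u and c = d, with c^4 = -1. *)
set y := 'X^s; set x := 'X; set w := u%:P; set c := d%:P in e4 *.
by combine ((4 * w * (y - x) - 4 * c ^+ 2 * w ^+ 2) *e e4
  +e (- w * (y - x) + 2 * c ^+ 2 * w ^+ 2) *e t0).
Qed.

Lemma heis_eq (u : I) :
  (heis_cocycle (val u))%:F ^+ 3 - (heis_cocycle (val u))%:F + b =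
  frac_shift (d ^+ 2 * val u) b.
Proof.
by rewrite frac_shift_tofrac -(heis_cocycle_eq (valP u)) !(tofracD, tofracN, tofracXn).
Qed.

Definition heis (u : I) : V -> V := twist (heis_eq u).
HB.instance Definition _ u := GRing.Additive.on (heis u).

Definition subfield_add (u v : I) : I :=
  exist _ (val u + val v) (in_subfield_add three0 (valP u) (valP v)).
Definition subfield_opp (u : I) : I := exist _ (- val u) (in_subfield_opp (valP u)).

Lemma subfield_add_injr v : injective (subfield_add v).
Proof. by move=> u u' /(congr1 val) /= /addrI /val_inj. Qed.

Lemma subfield_oppK : involutive subfield_opp.
Proof. by move=> u; apply: val_inj; rewrite /= opprK. Qed.

Definition cst (c : F) : K := (c%:P)%:F.

Lemma frac_shift_cst e c : frac_shift e (cst c) = cst c.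
Proof. by rewrite /cst frac_shift_tofrac /poly_shift comp_polyC. Qed.

(** The commutator pairing of the Heisenberg group. *)
Definition pairing (u w : I) : F := tr m (val u * val w).

Lemma pairing_cube u w : pairing u w ^+ 3 = pairing u w.
Proof.
apply/eqP; rewrite -subr_eq0 (tr_cube three0) subr_eq0.
exact: (in_subfield_mul (valP u) (valP w)).
Qed.

Lemma cst_pairing_cube u w : cst (pairing u w) ^+ 3 = cst (pairing u w).
Proof. by rewrite /cst -tofracXn -polyC_exp pairing_cube. Qed.

Definition pairing_tau (u w : I) : V -> V := tau (cst_pairing_cube u w).
HB.instance Definition _ u w := GRing.Additive.on (pairing_tau u w).

Lemma pairing_tauC u w P : pairing_tau u w P = pairing_tau w u P.
Proof. by apply: twist_ext; rewrite // /pairing mulrC. Qed.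

Lemma pairing_tauD u v w P :
  pairing_tau u w (pairing_tau v w P) = pairing_tau (subfield_add u v) w P.
Proof.
apply: tauD; rewrite /cst -tofracD -polyCD; congr (_%:P%:F).
by rewrite /pairing mulrDl (trD three0).
Qed.

Lemma pairing_tau0 u w P : val w = 0 -> pairing_tau u w P = P.
Proof.
move=> w0; apply: tau0; rewrite /cst /pairing w0 mulr0 /tr big1 ?tofrac0 //.
by move=> k _; rewrite expr0n -leqn0 leqNgt expn_gt0.
Qed.

(** The trace is a polynomial of degree 3^(m-1), too small to vanish on F_s. *)
Lemma pairing_nondegenerate w : val w != 0 -> exists u, pairing u w != 0.
Proof.
move=> w0; apply/existsP; apply: contraT; rewrite negb_exists => /forallP trw0.
pose p : {poly F} := \sum_(k < m) 'X^(3 ^ k).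
have size_p : size p = (3 ^ m.-1).+1.
  rewrite /p; case: (m) m_gt0 => // k _ /=.
  rewrite big_ord_recr /= addrC size_polyDl size_polyXn //.
  apply: leq_ltn_trans (size_sum _ _ _) _; apply/bigmax_leqP => i _.
  by rewrite size_polyXn ltn_exp2l.
have p0 : p != 0 by rewrite -size_poly_gt0 size_p.
have := max_poly_roots (rs := enum [pred w | Fs w]) p0.
rewrite enum_uniq -cardE card_in_subfield // size_p ltnS leq_exp2l // => /(_ _ isT) h.
suff : (m <= m.-1)%N by move: m_gt0; case: (m) => // k _; rewrite ltnn.
apply: h; apply/allP => v; rewrite mem_enum inE /= => hv.
have hu : Fs (v / val w) by apply: in_subfield_mul => //; apply/in_subfield_inv/(valP w).
have := trw0 (exist _ (v / val w) hu : I); rewrite negbK /pairing /= divfK // => /eqP e.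
rewrite rootE /p; apply/eqP; rewrite horner_sum -[RHS]e /tr.
by apply: eq_bigr => k _; rewrite hornerXn.
Qed.

(** Orthogonality of characters. The sum is fixed by a nontrivial translation of the
    x-coordinate, which has no affine fixed point. *)
Lemma sum_pairing_tau w P : val w != 0 -> \sum_(u : I) pairing_tau u w P = 0.
Proof.
move=> w0; have [v v0] := pairing_nondegenerate w0; set S := (X in X = 0).
have : pairing_tau v w S = S.
  rewrite raddf_sum /= [RHS](reindex_inj (@subfield_add_injr v)).
  by apply: eq_bigr => u _; rewrite pairing_tauD.
have e0 : cst (pairing v w) != 0 by rewrite /cst !(tofrac_eq0, polyC_eq0).
move: e0; rewrite /pairing_tau; move: (cst _) (cst_pairing_cube v w) => c hc c0.
clearbody S; case: S => [[[x y]|] h]; last by move=> _; apply: val_inj.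
move=> /(congr1 (fun Q : V => if val Q is Some (z, _) then z else 0)) /= /eqP.
by rewrite -subr_eq0 addrAC subrr add0r (negbTE c0).
Qed.

Lemma heis_pairing_tau u v w P : heis u (pairing_tau v w P) = pairing_tau v w (heis u P).
Proof. by apply: twist_tau; apply: frac_shift_cst. Qed.

Lemma heis_zeta u P : heis u (zeta P) = zeta (heis u P).
Proof. by apply: twist_tau; apply: rmorph1. Qed.

Lemma translate_zeta u P : translate u (zeta P) = zeta (translate u P).
Proof. by apply: twist_tau; apply: rmorph1. Qed.

Lemma translateD u v P : translate u (translate v P) = translate (subfield_add u v) P.
Proof. by apply: twist_comp => [x|]; rewrite ?frac_shift_add // rmorph0 addr0. Qed.

Lemma translate0 w P : val w = 0 -> translate w P = P.
Proof. by move=> w0; apply: twist_id => // x; rewrite w0 frac_shift0. Qed.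

Lemma heis_cocycle_shift u w : poly_shift w (heis_cocycle u) = heis_cocycle u + (tr m (u * w))%:P.
Proof.
have t0 := poly_three0 three0.
rewrite /heis_cocycle -tr_rmorph -[LHS](tr_rmorph (comp_poly ('X + w%:P))) /= -trD //.
congr tr; rewrite -/(poly_shift _ _) shiftB shiftZ shiftX /poly_shift comp_polyC scalerDr.
by rewrite addrAC -[w%:P]alg_polyC scalerA alg_polyC.
Qed.

Lemma heis_opp u P : heis (subfield_opp u) (heis u P) = P.
Proof.
have t0 := poly_three0 three0.
apply: val_inj; case: P => [[[x y]|] h] //=.
rewrite rmorphD /= !frac_shift_add mulrN addNr !frac_shift0 -addrA; congr (Some (_, _)).
rewrite -[RHS]addr0; congr (_ + _); rewrite frac_shift_tofrac heis_cocycle_shift -!tofracD.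
suff -> : heis_cocycle (val u) + (tr m (val u * - (d ^+ 2 * val u)))%:P +
    heis_cocycle (- val u) = 0 :> {poly F}.
  by rewrite tofrac0.
rewrite /heis_cocycle -(tr_rmorph (@polyC F)) -!trD // /tr big1 // => k _.
suff -> : val u *: 'X - (d ^+ 2 * val u ^+ 2)%:P + (val u * - (d ^+ 2 * val u))%:P +
   (- val u *: 'X - (d ^+ 2 * (- val u) ^+ 2)%:P) = 0 :> {poly F}.
  by rewrite expr0n -leqn0 leqNgt expn_gt0.
rewrite -!mul_polyC !(polyCM, polyCN, polyC_exp).
by combine (- d%:P ^+ 2 * (val u)%:P ^+ 2 *e t0).
Qed.

(** The commutation rule of the Heisenberg group: shifting t by w adds Tr(u w) to the
    cocycle of u. *)
Lemma translate_heis w u P : translate w (heis u P) = pairing_tau u w (heis u (translate w P)).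
Proof.
apply: val_inj; case: P => [[[x y]|] h] //=.
rewrite !rmorphD /= !frac_shift_add rmorph0 !addr0.
rewrite [(val w + _)]addrC -addrA; congr (Some (_ + _, _)).
by rewrite frac_shift_tofrac heis_cocycle_shift tofracD.
Qed.
End Maps.

(** * Points fixed by the translations *)

Lemma subr_subrK_add (V : zmodType) (a x y : V) : a - x - y + (x + y) = a.
Proof. by rewrite -[a - x - y]addrA -opprD subrK. Qed.

(** The sum with a point of x-coordinate 0, in a form whose numerator and denominator have
    visibly controlled degree. *)
Lemma add_x0 (K : fieldType) (three0 : 3 = 0 :> K) (b x y a : K)
    (h : y ^+ 2 = x ^+ 3 - x + b) (h0 : a ^+ 2 = 0 ^+ 3 - 0 + b) : x != 0 ->
  exists y' h', affine_pt three0 h + affine_pt three0 h0 =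
     @affine_pt K three0 b ((- x - a ^+ 2 + a * y) / x ^+ 2) y' h'.
Proof.
move=> x0; have c : chord ((y - a) / x) (x, y) (0, a).
  split=> /=; first by rewrite subr0 divfK.
  apply: (mulIf x0); rewrite mulrAC divfK // subr0.
  by combine (1 *e h +e -1 *e h0).
have [h' e] := add_affine_pt three0 h h0 c.
have ex : ((y - a) / x) ^+ 2 - x - 0 = (- x - a ^+ 2 + a * y) / x ^+ 2.
  have x20 : x ^+ 2 != 0 by rewrite expf_neq0.
  apply: (mulIf x20); rewrite divfK // subr0 mulrBl expr_div_n divfK //.
  by combine (1 *e h +e -1 *e h0 +e (a ^+ 2 - a * y) *e three0).
have h'' := h'; rewrite ex in h''.
by exists (y + a - ((y - a) / x) ^+ 3), h''; rewrite e; apply: eq_affine_pt.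
Qed.

Lemma add_x0_reduced (K : fieldType) (three0 : 3 = 0 :> K) (b X Y D a : K)
    (h : (Y / D ^+ 3) ^+ 2 = (X / D ^+ 2) ^+ 3 - X / D ^+ 2 + b)
    (h0 : a ^+ 2 = 0 ^+ 3 - 0 + b) : X != 0 -> D != 0 ->
  exists y', val (affine_pt three0 h + affine_pt three0 h0) =
    Some ((- X * D ^+ 2 - a ^+ 2 * D ^+ 4 + a * Y * D) / X ^+ 2, y').
Proof.
move=> X0 D0; have x0 : X / D ^+ 2 != 0 by rewrite mulf_neq0 ?invr_eq0 ?expf_neq0.
have [y' [h' ->]] := add_x0 three0 h h0 x0; exists y'; congr (Some (_, _)).
by field; rewrite X0.
Qed.

(** For polynomials with X prime to D, the fraction (X^3 + b D^6) / D^6 is in lowest terms, so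
    by the conclusion N and M are multiples of its numerator and denominator by one common
    polynomial. *)
Lemma phi_x_reduced (K : fieldType) (X D b N M : K) : D != 0 -> M != 0 ->
  (X / D ^+ 2) ^+ 3 + b = N / M -> (X ^+ 3 + b * D ^+ 6) * M = N * D ^+ 6.
Proof.
move=> D0 M0 e; have -> : (X ^+ 3 + b * D ^+ 6) = ((X / D ^+ 2) ^+ 3 + b) * D ^+ 6 by field.
by rewrite e; field.
Qed.

Section DegreeBounds.
Variable F : fieldType.

(** Bounds on degrees: size p <= i + 1 means deg p <= i, and covers p = 0. *)
Lemma degM (p q : {poly F}) i j : (size p <= i.+1)%N -> (size q <= j.+1)%N ->
  (size (p * q)%R <= (i + j).+1)%N.
Proof. by move=> hp hq; apply: leq_trans (size_polyMleq _ _) _; lia. Qed.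

Lemma degX (p : {poly F}) i n : (size p <= i.+1)%N -> (size (p ^+ n)%R <= (n * i).+1)%N.
Proof.
move=> hp; elim: n => [|n IH]; first by rewrite expr0 size_poly1.
by rewrite exprS mulSn degM.
Qed.

Lemma degD (p q : {poly F}) n : (size p <= n)%N -> (size q <= n)%N -> (size (p + q)%R <= n)%N.
Proof. by move=> hp hq; apply: leq_trans (size_polyD _ _) _; rewrite geq_max hp hq. Qed.

Lemma degN (p : {poly F}) n : (size p <= n)%N -> (size (- p)%R <= n)%N.
Proof. by rewrite size_polyN. Qed.

Lemma degW (p : {poly F}) i j : (i <= j)%N -> (size p <= i.+1)%N -> (size p <= j.+1)%N.
Proof. by move=> ij h; apply: leq_trans h _. Qed.

End DegreeBounds.

Section Descent.
Variables (F : finFieldType) (three0 : 3 = 0 :> F) (m : nat).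
Hypothesis (m_gt0 : (0 < m)%N).
Local Notation s := (3 ^ m)%N.
Hypothesis cardF : #|F| = (s ^ 2)%N.
Variables (d : F) (d4 : d ^+ 4 = -1).
Local Notation K := {fraction {poly F}}.
Local Notation A := (y0poly m d).
Local Notation B := (A ^+ 2).
Local Notation Fs := (@in_subfield F m).
Local Notation three0K := (frac_three0 three0).
Local Notation b := ((A ^+ 2)%:F).
Local Notation V := (twisted_points three0 m d).
Local Notation translate := (@translate F three0 m d).

Lemma base_point_on : A%:F ^+ 2 = 0 ^+ 3 - 0 + b :> K.
Proof. by rewrite expr0n subr0 add0r tofracXn. Qed.

Definition base_point : V := affine_pt three0K base_point_on.
Local Notation P0 := base_point.

Definition invariant_point (P : V) := forall w, translate w P = P.

Lemma base_point_invariant : invariant_point P0.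
Proof.
move=> w; apply: val_inj; rewrite /= rmorph0 addr0 frac_shift_tofrac.
by rewrite poly_shift_y0poly // (valP w).
Qed.

Definition reduced_form (Q : V) (X Y D : {poly F}) : Prop :=
  val Q = Some (X%:F / (D ^+ 2)%:F, Y%:F / (D ^+ 3)%:F) /\ reduced_on B X Y D.

Lemma reduced_formP (Q : V) : Q = 0 \/ exists X Y D, reduced_form Q X Y D.
Proof.
case: (ptP Q) => [|x y h]; [by left|right].
by have [X [Y [D [r ex ey]]]] := point_reduced h; exists X, Y, D; split=> //=; rewrite ex ey.
Qed.

Lemma monic_shift (w : F) (p : {poly F}) : p \is monic -> poly_shift w p \is monic.
Proof.
rewrite !monicE /poly_shift lead_coef_comp ?size_XaddC // => /eqP ->.
by rewrite lead_coefXaddC expr1n mulr1.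
Qed.

(** The reduced form is unique because D is monic. *)
Lemma reduced_form_invariant Q X Y D : invariant_point Q -> reduced_form Q X Y D ->
  shift_invariant m X /\ shift_invariant m D.
Proof.
move=> iQ [eQ [Dm cXD cYD _]].
suff inv w : Fs w -> poly_shift w X = X /\ poly_shift w D = D by split=> w /inv [].
move=> hw; have := congr1 val (iQ (exist _ w hw)); rewrite /= eQ /= addr0 => -[].
have D0 := monic_neq0 Dm; have D2m := monic_exp 2 Dm.
have sDm := monic_shift w D2m.
rewrite frac_shift_div => /eqP; rewrite eqr_div ?tofrac_eq0 ?monic_neq0 //.
rewrite -!tofracM tofrac_eq => /eqP e _.
have c1 : coprimep (D ^+ 2) X by rewrite coprimep_expl // coprimep_sym.
have c2 : coprimep (poly_shift w (D ^+ 2)) (poly_shift w X) by apply: coprimep_comp_poly.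
have e2 : poly_shift w (D ^+ 2) = D ^+ 2.
  apply: monic_dvdp_eq => //.
    have : poly_shift w (D ^+ 2) %| poly_shift w X * D ^+ 2 by rewrite e dvdp_mulIr.
    by rewrite Gauss_dvdpr.
  have : D ^+ 2 %| X * poly_shift w (D ^+ 2) by rewrite -e dvdp_mulIr.
  by rewrite Gauss_dvdpr.
split; first by apply: (mulIf (monic_neq0 D2m)); rewrite e e2.
have sD := monic_shift w Dm.
move/eqP: e2; rewrite shiftXn -eqp_monic ?monic_exp // => /andP[].
by rewrite !dvdp_pexp2r // => h1 h2; apply: monic_dvdp_eq.
Qed.

(** The multiple e P0 is chosen so that y + e d T has derivative 0, hence is a cube. *)
Lemma invariant_class Q : invariant_point Q ->
  exists2 e : int, e \in [:: 0; 1; -1] & is_cube (ycoord (Q + P0 *~ e)).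
Proof.
move=> iQ; have [->|[X [Y [D r]]]] := reduced_formP Q.
  by exists 0 => //; exists 0; rewrite mulr0z addr0 /ycoord /= expr0n.
have [iX iD] := reduced_form_invariant iQ r; have [eQ red] := r; have [Dm cXD cYD eY] := red.
have D0 := monic_neq0 Dm.
have sX := invariant_degree three0 m_gt0 cardF iX.
have sD := invariant_degree three0 m_gt0 cardF iD.
have [c cd Y'] := deriv_reduced three0 m_gt0 d4 red sX sD.
have key (e : F) : c = e * d -> is_cube (ycoord Q + (e *: A)%:F).
  move=> ce; have [r0 er] : exists r0, Y + e *: A * D ^+ 3 = r0 ^+ 3.
    apply: (deriv0_cube three0); rewrite derivD derivM derivZ Y' deriv_y0poly //.
    have -> : (D ^+ 3)^`() = 0.
      rewrite !exprS expr0 mulr1 !derivM.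
      by have t0 := poly_three0 three0; combine (D ^+ 2 * D^`() *e t0).
    by rewrite mulr0 addr0 scalerN -!mul_polyC ce polyCM mulNr subrr.
  exists (r0%:F / D%:F); rewrite /ycoord eQ expr_div_n -!tofracXn -er.
  rewrite tofracD mulrDl; congr (_ + _).
  by rewrite tofracM mulfK // tofrac_eq0 expf_neq0.
move: cd; rewrite !inE => /or3P[] /eqP ce.
- exists 0; rewrite ?inE // mulr0z addr0.
  by have := key 0; rewrite ce mul0r scale0r tofrac0 addr0; apply.
- exists 1; rewrite ?inE ?eqxx ?orbT // mulr1z.
  have := key 1; rewrite ce mul1r scale1r => /(_ (erefl _)) h.
  have := cubeD three0K (ycoordD Q P0) h.
  by rewrite [ycoord P0]/(A%:F) subr_subrK_add.
exists (-1); rewrite ?inE ?eqxx ?orbT // mulrN1z.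
have := key (-1); rewrite ce mulN1r scaleN1r => /(_ (erefl _)) h.
have := cubeD three0K (ycoordD Q (- P0)) h.
by rewrite ycoordN [ycoord P0]/(A%:F) tofracN subr_subrK_add.
Qed.

Lemma deg_y0poly : (size A <= s.+1)%N.
Proof. by rewrite size_y0poly. Qed.

(** The height of Q is the degree max(deg X, 2 deg D) of its x-coordinate. A bound is easier
    to use than the height itself since it does not require the reduced form to be unique. *)
Definition height_le (h : nat) (Q : V) : Prop :=
  Q = 0 \/ exists X Y D, [/\ reduced_form Q X Y D, (size X <= h.+1)%N & (2 * (size D).-1 <= h)%N].

Lemma height_le_exists Q : exists h, height_le h Q.
Proof.
have [->|[X [Y [D r]]]] := reduced_formP Q; first by exists 0%N; left.
exists (size X + 2 * (size D).-1)%N; right.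
by exists X, Y, D; split; rewrite ?leq_addl // leqW ?leq_addr.
Qed.

Lemma height_leW h h' Q : (h <= h')%N -> height_le h Q -> height_le h' Q.
Proof.
move=> hh [->|[X [Y [D [r sX sD]]]]]; [by left|right].
by exists X, Y, D; split=> //; [apply: degW sX|apply: leq_trans sD _].
Qed.

Lemma size_Y X Y D h : reduced_on B X Y D -> (size X <= h.+1)%N -> (2 * (size D).-1 <= h)%N ->
  (2 * (size Y).-1 <= 3 * h + 2 * s)%N.
Proof.
move=> [_ _ _ e] sX sD; have [->|Y0] := eqVneq Y 0; first by rewrite size_poly0.
have sD' : (size D <= ((size D).-1).+1)%N by rewrite leqSpred.
rewrite -ltnS -[(2 * (size Y).-1)%N]mulnC -size_expS // e.
apply: degD; first apply: degD.
- by apply: degW (degX 3 sX); move: sD; clear; lia.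
- by apply/degN; apply: degW (degM sX (degX 4 sD')); move: sD; clear; lia.
by apply: degW (degM (degX 2 deg_y0poly) (degX 6 sD')); move: sD; clear; lia.
Qed.

(** phi multiplies the height by 3, up to the degree 2 s of b: the fraction
    (X^3 + b D^6) / D^6 is again in lowest terms. *)
Lemma phi_height (Q : V) (N M : {poly F}) (y : K) h :
    val (phi Q) = Some (N%:F / M%:F, y) -> M != 0 ->
  (size N <= h.+1)%N -> (size M <= h.+1)%N -> height_le ((h + 2 * s) %/ 3) Q.
Proof.
move=> eQ M0 sN sM; have [->|[X [Y [D r]]]] := reduced_formP Q; first by left.
right; exists X, Y, D; have [eQ' [Dm cXD cYD eY]] := r.
have D0 := monic_neq0 Dm.
have e : (X ^+ 3 + B * D ^+ 6) * M = N * D ^+ 6.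
  move: eQ; rewrite val_phi eQ' tofracXn => -[/phi_x_reduced + _].
  rewrite !tofrac_eq0 D0 M0 => /(_ isT isT) /eqP.
  by rewrite -!(tofracXn, tofracM, tofracD) tofrac_eq => /eqP.
set G := X ^+ 3 + _ in e.
have cDG : coprimep (D ^+ 6) G.
  rewrite coprimep_expl // /G.
  have -> : X ^+ 3 + B * D ^+ 6 = (B * D ^+ 5) * D + X ^+ 3 by ring.
  by rewrite coprimep_addl_mul coprimep_expr // coprimep_sym.
have /dvdpP[g eg] : D ^+ 6 %| M.
  have : D ^+ 6 %| G * M by rewrite e dvdp_mulIr.
  by rewrite Gauss_dvdpr.
have D60 : D ^+ 6 != 0 by rewrite expf_neq0.
have g0 : g != 0 by apply: contraNneq M0 => g0; rewrite eg g0 mul0r.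
have eN : N = G * g by apply: (mulIf D60); rewrite -e eg mulrA.
have sD6 : (6 * (size D).-1 <= h)%N.
  rewrite -ltnS mulnC -size_expS //; apply: leq_trans sM.
  by apply: dvdp_leq => //; rewrite eg dvdp_mulIr.
have sG : (size G <= h.+1)%N.
  have [->|G0] := eqVneq G 0; first by rewrite size_poly0.
  apply: leq_trans sN; apply: dvdp_leq; first by rewrite eN mulf_neq0.
  by rewrite eN dvdp_mulIl.
split=> //; last by rewrite leq_divRL //; move: sD6; clear; lia.
have [->|X0] := eqVneq X 0; first by rewrite size_poly0.
have sD' : (size D <= ((size D).-1).+1)%N by rewrite leqSpred.
have sX3 : (size (X ^+ 3)%R <= (h + 2 * s).+1)%N.
  have -> : X ^+ 3 = G - B * D ^+ 6 by rewrite /G addrK.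
  apply: degD; first by apply: degW sG; clear; lia.
  by apply/degN; apply: degW (degM (degX 2 deg_y0poly) (degX 6 sD')); move: sD6; clear; lia.
have sX : ((size X).-1 <= (h + 2 * s) %/ 3)%N by rewrite leq_divRL // -ltnS -size_expS.
by apply: leq_trans (leqSpred _) _.
Qed.

Lemma translate_phi w (Q : V) : translate w (phi Q) = phi (translate w Q).
Proof. exact: twist_phi. Qed.

(** Adding P0 or - P0 at most doubles the height, up to 2 s, by [add_x0_reduced]; dividing by
    phi then divides it by 3, again up to 2 s, by [phi_height]. *)
Lemma descent Q h : invariant_point Q -> height_le h Q ->
  exists (e : int) (Q' : V), [/\ invariant_point Q', Q + P0 *~ e = phi Q' &
    height_le ((2 * h + 4 * s) %/ 3) Q'].
Proof.
move=> iQ [->|[X [Y [D [r sX sD]]]]].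
  exists 0, 0; split; [by move=> w; rewrite raddf0|by rewrite mulr0z addr0 raddf0|by left].
have [eQ red] := r; have [Dm cXD cYD eY] := red; have D0 := monic_neq0 Dm.
have sY := size_Y red sX sD.
have sD' : (size D <= ((size D).-1).+1)%N by rewrite leqSpred.
have sY' : (size Y <= ((size Y).-1).+1)%N by rewrite leqSpred.
have [X0|X0] := eqVneq X 0.
  have z0 : invariant_point 0 by move=> w; rewrite raddf0.
  have [e eA] : exists e : int, Q + P0 *~ e = 0.
    move: eQ; rewrite X0 tofrac0 mul0r; case: (ptP Q) => // x y hy [ex ey].
    have hy' := hy; rewrite ex -base_point_on in hy'.
    move/eqP: hy'; rewrite eqf_sqr => /orP[] /eqP e.
      exists (-1); rewrite mulrN1z; apply/eqP; rewrite subr_eq0; apply/eqP.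
      exact: eq_affine_pt.
    exists 1; rewrite mulr1z /base_point; have [h' eN] := opp_affine_pt three0K hy.
    apply/eqP; rewrite addrC addr_eq0 eN; apply/eqP; apply: eq_affine_pt => //.
    by rewrite e opprK.
  by exists e, 0; split=> //; [rewrite eA raddf0|left].
have [e ein cub] := invariant_class iQ.
have [Q' eQ'] := phi_descent cub.
exists e, Q'; split=> //.
  move=> w; apply: (@phi_inj _ three0K b); rewrite -translate_phi -eQ' raddfD raddfMz /=.
  by rewrite iQ base_point_invariant.
have -> : (2 * h + 4 * s = (2 * h + 2 * s) + 2 * s)%N by clear; lia.
have X20 : X ^+ 2 != 0 by rewrite expf_neq0.
have main (a : {poly F}) (ha : a%:F ^+ 2 = 0 ^+ 3 - 0 + b) : (size a <= s.+1)%N ->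
   Q + affine_pt three0K ha = phi Q' -> height_le ((2 * h + 2 * s + 2 * s) %/ 3) Q'.
  move=> sa.
  have : val Q = Some (X%:F / D%:F ^+ 2, Y%:F / D%:F ^+ 3).
    by rewrite eQ -[D%:F ^+ 2]tofracXn -[D%:F ^+ 3]tofracXn.
  case: (ptP Q) => // x y hy [ex ey] eQQ'.
  subst x y. pose N := - X * D ^+ 2 - a ^+ 2 * D ^+ 4 + a * Y * D.
  have XK0 : X%:F != 0 by rewrite tofrac_eq0.
  have DK0 : D%:F != 0 by rewrite tofrac_eq0.
  have [y' ev] := add_x0_reduced three0K hy ha XK0 DK0.
  have eN : N%:F = - X%:F * D%:F ^+ 2 - a%:F ^+ 2 * D%:F ^+ 4 + a%:F * Y%:F * D%:F.
    by rewrite /N !(tofracB, tofracD, tofracN, tofracM, tofracXn).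
  apply: (phi_height (N := N) (M := X ^+ 2) (y := y')) => //.
  - by rewrite -eQQ' ev -eN; congr (Some (_ / _, _)); apply/esym/tofracXn.
  - apply: degD; first apply: degD.
    + by apply: degW (degM (degN sX) (degX 2 sD')); move: sD; clear; lia.
    + by apply/degN; apply: degW (degM (degX 2 sa) (degX 4 sD')); move: sD; clear; lia.
    apply: degW (degM (degM sa sY') sD'); move: sD sY; move: (size Y).-1 (size D).-1; clear.
    by move: s => l u v; lia.
  by apply: degW (degX 2 sX); clear; lia.
move: ein; rewrite !inE => /or3P[] /eqP ee.
- apply: (phi_height (N := X) (M := D ^+ 2)); rewrite ?expf_neq0 -?eQ' ?ee ?mulr0z ?addr0 ?eQ //.
    by apply: degW sX; clear; lia.
  by apply: degW (degX 2 sD'); move: sD; clear; lia.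
- by apply: (main A base_point_on); rewrite ?deg_y0poly // -eQ' ee mulr1z.
have hN : (- A)%:F ^+ 2 = 0 ^+ 3 - 0 + b by rewrite tofracN sqrrN base_point_on.
apply: (main (- A) hN); first by apply/degN/deg_y0poly.
rewrite -eQ' ee mulrN1z; have [h' ->] := opp_affine_pt three0K base_point_on.
by congr (_ + _); apply: eq_affine_pt => //; rewrite tofracN.
Qed.
End Descent.

(** * Torsion modulo the lattice of one point *)

Section Lattice.
Variables (K : fieldType) (three0 : 3 = 0 :> K) (b : K).
Local Notation as_point := (as_point three0 b).
Local Notation phi := (@phi K three0 b).
Variable P0 : as_point.

(** The Z[zeta]-module generated by P0. *)
Definition in_lattice (Q : as_point) := exists a c : int, Q = P0 *~ a + zeta P0 *~ c.

Lemma in_lattice0 : in_lattice 0.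
Proof. by exists 0, 0; rewrite !mulr0z addr0. Qed.

Lemma in_lattice_gen e : in_lattice (P0 *~ e).
Proof. by exists e, 0; rewrite mulr0z addr0. Qed.

Lemma in_latticeD Q R : in_lattice Q -> in_lattice R -> in_lattice (Q + R).
Proof.
by move=> [a [c ->]] [a' [c' ->]]; exists (a + a'), (c + c'); rewrite addrACA -!mulrzDr.
Qed.

Lemma in_latticeM Q n : in_lattice Q -> in_lattice (Q *~ n).
Proof.
by move=> [a [c ->]]; exists (a * n), (c * n); rewrite mulrzDl -!mulrzA.
Qed.

Lemma in_latticeN Q : in_lattice Q -> in_lattice (- Q).
Proof. by move/(in_latticeM (-1)); rewrite mulrN1z. Qed.

Lemma in_lattice_zeta Q : in_lattice Q -> in_lattice (zeta Q).
Proof.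
move=> [a [c ->]]; exists (- c), (a - c).
rewrite raddfD /= !raddfMz /= zeta_zeta mulrNz mulrzBl mulNrz mulrzBr.
by rewrite addrCA addrA.
Qed.

Lemma in_lattice_phi Q : in_lattice Q -> in_lattice (phi Q).
Proof.
move=> hQ; rewrite phiE.
by apply: in_latticeD; [|apply: in_latticeN]; do ?apply: in_lattice_zeta.
Qed.

Definition torsion_mod (Q : as_point) := exists2 N : int, N != 0 & in_lattice (Q *~ N).

Lemma torsion_mod_shift Q R : in_lattice (Q - R) -> torsion_mod R -> torsion_mod Q.
Proof.
move=> h [N N0 hR]; exists N => //; rewrite -(subrK R Q) mulrzDl.
by apply: in_latticeD => //; apply: in_latticeM.
Qed.

Lemma torsion_mod_phi Q : torsion_mod Q -> torsion_mod (phi Q).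
Proof. by move=> [N N0 hQ]; exists N => //; rewrite -raddfMz; apply: in_lattice_phi. Qed.

Lemma in_lattice_trans Q R S : in_lattice (Q - R) -> in_lattice (R - S) -> in_lattice (Q - S).
Proof. by move=> h1 h2; rewrite -(subrK R Q) -addrA; apply: in_latticeD. Qed.

Lemma in_lattice_phiB Q R : in_lattice (Q - R) -> in_lattice (phi Q - phi R).
Proof. by rewrite -raddfB; apply: in_lattice_phi. Qed.

Lemma in_lattice_iter_phiB k Q R : in_lattice (Q - R) -> in_lattice (iter k phi Q - iter k phi R).
Proof. by move=> h; elim: k => [|k IH] //=; apply: in_lattice_phiB. Qed.

Lemma chain_in_lattice (g : nat -> as_point) n :
    (forall k, (k < n)%N -> in_lattice (g k - phi (g k.+1))) ->
  forall j k, (j <= k <= n)%N -> in_lattice (g j - iter (k - j) phi (g k)).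
Proof.
move=> hg j; elim=> [|k IH] /andP[jk kn].
  by move: jk; rewrite leqn0 => /eqP ->; rewrite subnn subrr; apply: in_lattice0.
move: jk; rewrite leq_eqVlt => /orP[/eqP ->|jk]; first by rewrite subnn subrr; apply: in_lattice0.
rewrite subSn // iterSr; apply: in_lattice_trans (IH _) _; first by rewrite -ltnS jk ltnW.
exact/in_lattice_iter_phiB/hg.
Qed.

Lemma iter_phi_double r Q : iter r.*2 phi Q = Q *~ ((-3) ^+ r).
Proof.
elim: r => [|r IH]; first by rewrite expr0 mulr1z.
by rewrite doubleS !iterS IH phi_phi exprS mulrC mulrzA mulrNz.
Qed.

(** R is congruent to phi^(2r) R = (-3)^r R, so it is killed by 1 - (-3)^r. *)
Lemma cycle_torsion_mod R r : (0 < r)%N -> in_lattice (R - iter r phi R) -> torsion_mod R.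
Proof.
move=> r0 h; exists (1 - (-3) ^+ r).
  rewrite subr_eq0; apply/eqP => /(congr1 absz); rewrite abszX => /= e.
  by have := ltn_exp2l 0 r (isT : 1 < 3)%N; rewrite expn0 -e r0.
rewrite mulrzBr mulr1z -iter_phi_double.
by apply: (in_lattice_trans h); rewrite -addnn iterD; apply: in_lattice_iter_phiB; exact: h.
Qed.
End Lattice.

Section Finiteness.
Variables (F : finFieldType) (three0 : 3 = 0 :> F) (m : nat).
Hypothesis (m_gt0 : (0 < m)%N).
Local Notation s := (3 ^ m)%N.
Hypothesis cardF : #|F| = (s ^ 2)%N.
Variables (d : F) (d4 : d ^+ 4 = -1).
Local Notation V := (twisted_points three0 m d).
Local Notation P0 := (base_point three0 m d).
Local Notation phi := (@phi _ (frac_three0 three0) ((y0poly m d ^+ 2)%:F)).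

Definition code n := option ('rV[F]_n * 'rV[F]_n * 'rV[F]_n).

(** Points of bounded height are coded by row vectors of coefficients, to make their
    finiteness explicit. *)
Definition decode n (c : code n) : option ({fraction {poly F}} * {fraction {poly F}}) :=
  if c is Some (x, y, z) then
    Some ((rVpoly x)%:F / (rVpoly z ^+ 2)%:F, (rVpoly y)%:F / (rVpoly z ^+ 3)%:F)
  else None.

Lemma height_le_code h : exists n, forall Q : V, height_le h Q ->
  exists c : code n, val Q = decode c.
Proof.
(* 2 deg Y <= 3 h + 2 s, so this bounds the sizes of X, Y and D. *)
exists (2 * h + s + 2)%N => Q [->|[X [Y [D [[eQ r] sX sD]]]]]; first by exists None.
have sY := size_Y m_gt0 d4 r sX sD.
have k (X0 : {poly F}) : (size X0 <= 2 * h + s + 2)%N ->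
    rVpoly (poly_rV X0 : 'rV[F]_(2 * h + s + 2)) = X0.
  by move=> hX; rewrite poly_rV_K.
have kX : (size X <= 2 * h + s + 2)%N by move: sX; clear; lia.
have kY : (size Y <= 2 * h + s + 2)%N by move: sY; case: (size Y) => [|e]; clear; lia.
have kD : (size D <= 2 * h + s + 2)%N by move: sD; case: (size D) => [|e]; clear; lia.
by exists (Some (poly_rV X, poly_rV Y, poly_rV D)); rewrite /= (k X) // (k Y) // (k D).
Qed.

Lemma bounded_chain Q : invariant_point Q -> height_le (4 * s) Q -> forall n, exists g : nat -> V,
  [/\ g 0%N = Q, forall k, invariant_point (g k) /\ height_le (4 * s) (g k) &
      forall k, (k < n)%N -> in_lattice P0 (g k - phi (g k.+1))].
Proof.
move=> iQ hQ; elim=> [|n [g [g0 hg cg]]]; first by exists (fun=> Q); split.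
have [e [Q' [iQ' eQ' hQ']]] := descent m_gt0 cardF d4 (hg n).1 (hg n).2.
(* 4 s is the fixed point of h -> (2 h + 4 s) / 3. *)
have {}hQ' : height_le (4 * s) Q'.
  by apply: height_leW hQ'; rewrite (_ : _ + _ = 4 * s * 3)%N ?mulnK //; clear; lia.
exists (fun k => if (k <= n)%N then g k else Q'); split; first by rewrite leq0n.
  by move=> k; case: ifP.
move=> k; rewrite ltnS leq_eqVlt => /orP[/eqP ->|kn]; last by rewrite kn orbT; apply: cg.
rewrite eqxx ltnn -eQ' opprD addrA subrr add0r -mulrNz; exact: in_lattice_gen.
Qed.

(** A chain longer than the number of codes visits a point twice. *)
Lemma bounded_torsion_mod Q : invariant_point Q -> height_le (4 * s) Q -> torsion_mod P0 Q.
Proof.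
move=> iQ hQ; have [n hn] := height_le_code (4 * s).
have [g [g0 hg cg]] := bounded_chain iQ hQ #|{: code n}|.+1.
have [c ec] := fin_all_exists (fun k : 'I_#|{: code n}|.+1 => hn (g k) (hg k).2).
have /injectivePn[j [k jk ejk]] : ~~ injectiveb c.
  apply/negP => /injectiveP /leq_card; by rewrite card_ord ltnn.
wlog lt_jk : j k jk ejk / (j < k)%N => [hw|].
  have [/hw|/hw|/val_inj e] := ltngtP j k; [by apply|by apply; rewrite // eq_sym|].
  by rewrite e eqxx in jk.
have eg : g j = g k by apply: val_inj; rewrite !ec ejk.
have kn : (k <= #|{: code n}|.+1)%N by rewrite ltnW // ltn_ord.
have tj : torsion_mod P0 (g j).
  apply: (@cycle_torsion_mod _ _ _ _ _ (k - j)); first by rewrite subn_gt0.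
  by rewrite {2}eg; apply: (chain_in_lattice cg); rewrite ltnW.
have h0 := chain_in_lattice cg (j := 0%N) (k := j); rewrite g0 subn0 in h0.
apply: torsion_mod_shift (h0 _) _; first by rewrite leq0n (leq_trans (ltnW lt_jk)).
by move: (g j) tj => x tx; elim: (j : nat) => [|i IH] //=; apply: torsion_mod_phi.
Qed.

(** Above 4 s the height decreases strictly. *)
Lemma invariant_torsion_mod Q : invariant_point Q -> torsion_mod P0 Q.
Proof.
have [h hQ] := height_le_exists Q; have [N leN] := ubnP h.
elim: N Q h leN hQ => // N IH Q h leN hQ iQ.
have [h4|h4] := leqP h (4 * s); first by apply: bounded_torsion_mod => //; apply: height_leW hQ.
have [e [Q' [iQ' eQ' hQ']]] := descent m_gt0 cardF d4 iQ hQ.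
apply: (@torsion_mod_shift _ _ _ _ _ (phi Q')).
  by rewrite -eQ' opprD addrA subrr add0r -mulrNz; apply: in_lattice_gen.
apply: torsion_mod_phi; apply: IH hQ' iQ'.
rewrite ltn_divLR //; move: leN h4; clear; lia.
Qed.
End Finiteness.

(** * Rank of an abelian group *)

Section Rank.
Variable V : zmodType.

Definition free_family (J : finType) (v : J -> V) : Prop :=
  forall c : J -> int, \sum_j v j *~ c j = 0 -> forall j, c j = 0.

Definition spans_up_to_torsion (J : finType) (v : J -> V) : Prop :=
  forall x, exists N : int, exists c : J -> int, N != 0 /\ x *~ N = \sum_j v j *~ c j.

Lemma int_row_kernel (n r : nat) (C : 'M[int]_(n, r)) : (r < n)%N ->
  exists u : 'I_n -> int, (exists i, u i != 0) /\ forall j, \sum_i u i * C i j = 0.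
Proof.
move=> rn; pose Cq : 'M[rat]_(n, r) := map_mx intr C.
have : kermx Cq != 0.
  rewrite -mxrank_eq0 mxrank_ker subn_eq0 -ltnNge.
  by apply: leq_ltn_trans (rank_leq_col _) rn.
move=> /rowV0Pn[w /sub_kermxP wC w0].
(* D clears the denominators of a rational kernel vector w. *)
pose D : int := \prod_i denq (w 0 i).
have D0 : D != 0 by apply/prodf_neq0 => i _; apply: denq_neq0.
pose u i : int := numq (w 0 i) * \prod_(k | k != i) denq (w 0 k).
have uE i : (u i)%:~R = w 0 i * D%:~R :> rat.
  rewrite /u /D [\prod_j denq (w 0 j)](bigD1 i) //= !intrM mulrA; congr (_ * _).
  by rewrite -{2}[w 0 i]divq_num_den divfK // intr_eq0 denq_neq0.
exists u; split.
  have /rV0Pn[i wi] := w0; exists i.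
  by rewrite -(intr_eq0 rat) uE mulf_neq0 // intr_eq0.
move=> j; apply/eqP; rewrite -(intr_eq0 rat) rmorph_sum /=.
have := congr1 (fun M : 'rV_r => M 0 j) wC; rewrite !mxE => e.
under eq_bigr do rewrite intrM uE mulrAC.
rewrite -mulr_suml.
have -> : \sum_i w 0 i * (C i j)%:~R = 0 :> rat.
  by rewrite -[RHS]e; apply: eq_bigr => i _; rewrite mxE.
by rewrite mul0r.
Qed.

(** Multiples of the v i are integral combinations of #|J| elements, so more than #|J| of them
    satisfy an integral relation. *)
Lemma free_le_span (J : finType) (g : J -> V) (n : nat) (v : 'I_n -> V) :
  spans_up_to_torsion g -> free_family v -> (n <= #|J|)%N.
Proof.
move=> sg fv; rewrite leqNgt; apply/negP => lt.
have /fin_all_exists[N /fin_all_exists[c hc]] : forall i, exists N : int, exists c : J -> int,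
  N != 0 /\ v i *~ N = \sum_j g j *~ c j by move=> i; apply: sg.
have [u [[i ui] hu]] := int_row_kernel (\matrix_(i < n, k < #|J|) c i (enum_val k)) lt.
have /fv /(_ i) /eqP : \sum_i v i *~ (N i * u i) = 0.
  under eq_bigr => k _ do rewrite mulrzA (hc k).2 mulrz_suml.
  rewrite exchange_big /= big1 // => j _.
  under eq_bigr => k _ do rewrite -mulrzA mulrC.
  rewrite -mulrz_sumr; have := hu (enum_rank j).
  by under eq_bigr => k _ do rewrite mxE enum_rankK; move=> ->; rewrite mulr0z.
by rewrite mulf_eq0 (negbTE ui) (negbTE (hc i).1).
Qed.

End Rank.

(** * The rank of the curve *)

Section Assembly.
Variables (F : finFieldType) (three0 : 3 = 0 :> F) (m : nat).
Hypothesis (m_gt0 : (0 < m)%N) (m_odd : odd m).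
Local Notation s := (3 ^ m)%N.
Hypothesis cardF : #|F| = (s ^ 2)%N.
Variables (d : F) (d4 : d ^+ 4 = -1).
Local Notation V := (twisted_points three0 m d).
Local Notation P0 := (base_point three0 m d).
Local Notation translate := (@translate F three0 m d).
Local Notation heis := (@heis F three0 m m_odd d d4).
Local Notation pairing_tau := (@pairing_tau F three0 m d).
Local Notation I := (subfield_elt F m).
Local Notation subfield_opp := (@subfield_opp F m).

Definition trace (x : V) : V := \sum_(w : I) translate w x.

Lemma trace_invariant x : invariant_point (trace x).
Proof.
move=> v; rewrite raddf_sum /= [RHS](reindex_inj (@subfield_add_injr F three0 m v)).
by apply: eq_bigr => w _; rewrite translateD.
Qed.

Lemma heisK u : cancel (heis u) (heis (subfield_opp u)).
Proof. by move=> x; apply: heis_opp. Qed.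

Lemma heisVK u : cancel (heis (subfield_opp u)) (heis u).
Proof. by move=> x; have := heis_opp m_odd d4 (subfield_opp u) x; rewrite subfield_oppK. Qed.

Lemma subfield_zero : exists w : I, val w = 0.
Proof.
have h : in_subfield m (0 : F) by rewrite /in_subfield expr0n -[(_ == 0)%N]leqn0 leqNgt expn_gt0.
by exists (exist _ 0 h).
Qed.

(** The conjugate of translate w by heis u is translate w up to zeta^(- Tr(u w)); summing over
    u kills all w except 0. *)
Lemma trace_decomposition x : \sum_(u : I) heis u (trace (heis (subfield_opp u) x)) = x *+ s.
Proof.
have [w0 w00] := subfield_zero.
have E u w : heis u (translate w (heis (subfield_opp u) x)) =
    pairing_tau (subfield_opp u) w (translate w x).
  by rewrite translate_heis heis_pairing_tau heisVK.
under eq_bigr => u _ do (rewrite raddf_sum /=; under eq_bigr => w _ do rewrite E).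
rewrite exchange_big (bigD1 w0) //= [X in _ + X]big1 => [|w nw].
  rewrite addr0; under eq_bigr => u _ do rewrite (pairing_tau0 _ _ w00) (translate0 _ w00).
  by rewrite sumr_const card_subfield_elt.
rewrite -(reindex_inj (inv_inj (@subfield_oppK F m)) (P := xpredT)
  (F := fun u => pairing_tau u w (translate w x))).
apply: (sum_pairing_tau m_gt0 cardF); apply: contraNneq nw => w_0; apply/eqP/val_inj.
by rewrite /= w00 -w_0.
Qed.

Definition generator (j : I * bool) : V :=
  if j.2 then zeta (heis j.1 P0) else heis j.1 P0.

Lemma sum_generator (c : I * bool -> int) :
  \sum_j generator j *~ c j =
  \sum_u heis u (P0 *~ c (u, false) + zeta P0 *~ c (u, true)).
Proof.
rewrite (eq_bigr (fun j => generator (j.1, j.2) *~ c (j.1, j.2))); last by case.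
rewrite -(pair_bigA _ (fun u t => generator (u, t) *~ c (u, t))) /=.
apply: eq_bigr => u _; rewrite big_bool /generator /= addrC.
by rewrite raddfD !raddfMz /= heis_zeta.
Qed.

Lemma generator_spans : spans_up_to_torsion generator.
Proof.
move=> x; pose R u := trace (heis (subfield_opp u) x).
have Rt u : exists N a c : int, N != 0 /\ R u *~ N = P0 *~ a + zeta P0 *~ c.
  have [N n0 [a [c e]]] := invariant_torsion_mod m_gt0 cardF d4
    (trace_invariant (heis (subfield_opp u) x)).
  by exists N, a, c.
have [N hN] := fin_all_exists Rt.
have [a ha] := fin_all_exists hN; have [c hc] := fin_all_exists ha.
pose D u := \prod_(k | k != u) N k.
exists (s%:Z * \prod_u N u), (fun j => (if j.2 then c j.1 else a j.1) * D j.1); split.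
  rewrite mulf_neq0 ?pnatr_eq0 ?expn_eq0 //; first by rewrite -lt0n expn_gt0.
  by apply/prodf_neq0 => u _; have [] := hc u.
rewrite sum_generator mulrzA -[x *~ s%:Z]/(x *+ s) -trace_decomposition mulrz_suml.
apply: eq_bigr => u _; rewrite /= !mulrzA -mulrzDl raddfMz -(hc u).2 (bigD1 u) //=.
by rewrite mulrzA (raddfMz (heis u)) /R /D.
Qed.

(** A polynomial that is a cube in K is the cube of a polynomial, so it has derivative 0,
    whereas (d T)' = - d. *)
Lemma base_point_noncube : ~ is_cube (ycoord P0).
Proof.
move=> [z]; rewrite /ycoord /= => e.
have [p [q [qm cpq ez]]] := frac_reduced z.
have q0 := monic_neq0 qm.
have {}e : y0poly m d * q ^+ 3 = p ^+ 3.
  apply/eqP; rewrite -tofrac_eq tofracM !tofracXn e ez expr_div_n divfK //.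
  by rewrite expf_neq0 // tofrac_eq0.
have q3 : q ^+ 3 = 1.
  apply: monic_dvdp_eq; rewrite ?monic_exp ?monic1 ?dvd1p //.
  have : q ^+ 3 %| y0poly m d * q ^+ 3 by rewrite dvdp_mulIr.
  rewrite e -[p ^+ 3]mul1r Gauss_dvdpl //.
  by rewrite coprimep_expl // coprimep_expr // coprimep_sym.
rewrite q3 mulr1 in e; have := congr1 deriv e; rewrite deriv_y0poly //.
rewrite deriv_exp -mulr_natr (poly_three0 three0) mulr0 => /eqP.
by rewrite oppr_eq0 polyC_eq0 (negbTE (d_neq0 d4)).
Qed.

(** The point heis u P0 is an eigenvector of all translations with the character
    w -> zeta^(Tr (u w)); for distinct u these are distinct. *)
Lemma generator_free : free_family generator.
Proof.
move=> c; rewrite sum_generator.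
pose y u := P0 *~ c (u, false) + zeta P0 *~ c (u, true) => e0.
have iy u : invariant_point (y u).
  by move=> w; rewrite raddfD !raddfMz /= translate_zeta base_point_invariant.
have E u w : translate w (heis u (y u)) = pairing_tau u w (heis u (y u)).
  by rewrite translate_heis iy.
(* Project onto the u0-component with the sum over w of zeta^(- Tr (u0 w)) translate w. *)
have y0 u0 : y u0 *+ s = 0.
  apply: (can_inj (heisK u0)); rewrite raddf0 raddfMn /=.
  rewrite -(card_subfield_elt three0 m_gt0 cardF) -sumr_const.
  have := congr1 (fun x => \sum_(w : I) pairing_tau (subfield_opp u0) w (translate w x)) e0.
  rewrite /= [RHS]big1 => [e1|w _]; last by rewrite !raddf0.
  apply: etrans e1.
  under [RHS]eq_bigr => w _.
    rewrite raddf_sum raddf_sum /=.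
    under eq_bigr => u _ do rewrite E pairing_tauD pairing_tauC.
    over.
  rewrite [RHS]exchange_big [RHS](bigD1 u0) //= [X in _ + X]big1 => [|u nu].
    rewrite addr0; apply: eq_big => // w _.
    by rewrite pairing_tau0 //= addNr.
  apply: (sum_pairing_tau m_gt0 cardF); rewrite /= addrC subr_eq0.
  by apply: contraNneq nu => /val_inj ->.
have torsfree u0 : c (u0, false) = 0 /\ c (u0, true) = 0.
  have : P0 *~ (c (u0, false) * s%:Z) + zeta P0 *~ (c (u0, true) * s%:Z) = 0.
    by rewrite !mulrzA -mulrzDl; apply: y0.
  have s0 : s%:Z != 0 by rewrite eqz_nat -lt0n expn_gt0.
  move/noncube_Zzeta_free => [|]; first exact: base_point_noncube.
  by move=> /eqP + /eqP; rewrite !mulf_eq0 (negbTE s0) !orbF => /eqP + /eqP.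
by case=> u [] ; have [] := torsfree u.
Qed.
End Assembly.

Lemma rank_of_spanning_free_family (K : fieldType) (three0 : 3 = 0 :> K) (b : K) (J : finType)
    (g : J -> as_point three0 b) : free_family g -> spans_up_to_torsion g ->
  mordell_weil_rank (as_curve three0 b) #|J|.
Proof.
have indep n (P : 'I_n -> as_point three0 b) :
    @independent K (as_curve three0 b) n P <-> free_family P.
  by split=> fP c e; apply: fP; rewrite -[RHS]e; apply: eq_bigr => i _; rewrite mulz_pointE.
move=> fg sg; split; last by move=> n P /indep; apply: free_le_span.
exists (fun i => g (enum_val i)); apply/indep => c e j.
have := fg (fun x => c (enum_rank x)).
rewrite (reindex (@enum_val J xpredT)) /=; last exact/onW_bij/enum_val_bij.
by under eq_bigr => i _ do rewrite enum_valK; move=> /(_ e (enum_val j)); rewrite enum_valK.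
Qed.

(** Half of the nonzero elements are not (q-1)/2-th roots of 1; raise such an element to the
    power (q-1)/8. *)
Lemma minus_one_fourth_power (F : finFieldType) : (8 %| #|F|.-1)%N ->
  exists d : F, d ^+ 4 = -1.
Proof.
move=> /dvdnP[k ek].
have q_gt1 := finNzRing_gt1 F; have k_gt0 : (0 < k)%N.
  by case: (posnP k) => // k0; move: q_gt1; rewrite -subn_gt0 subn1 ek k0.
(* 'X^(k * 4) - 1 has fewer roots than F has nonzero elements. *)
have [x x0 xk] : exists2 x : F, x != 0 & x ^+ (k * 4) != 1.
  apply/exists_inP; apply: contraT; rewrite negb_exists_in => /forall_inP all1.
  have p0 : 'X^(k * 4) - 1 != 0 :> {poly F}.
    by rewrite -size_poly_gt0 size_XnsubC // muln_gt0 k_gt0.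
  have := max_poly_roots (rs := enum (predC1 (0 : F))) p0.
  rewrite enum_uniq -cardE cardC1 size_XnsubC ?muln_gt0 ?k_gt0 // ltnS ek leq_pmul2l //.
  apply=> //; apply/allP => x; rewrite mem_enum inE => /all1; rewrite negbK => /eqP xk.
  by rewrite rootE !hornerE xk subrr.
exists (x ^+ k); rewrite -exprM; apply/eqP.
have : (x ^+ (k * 4)) ^+ 2 == 1.
  rewrite -exprM -mulnA -ek; apply/eqP/(mulfI x0).
  by rewrite -exprS prednK ?mulr1 ?expf_card // ltnW.
by rewrite sqrf_eq1 (negbTE xk).
Qed.

Theorem theoremC (M : nat) :
  exists (k q : nat) (F : finFieldType)
         (E : elliptic_curve {fraction {poly F}}) (r : nat),
    [/\ q = (3 ^ k)%N,
        #|F| = q,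
        mordell_weil_rank E r,
        r%:R = 2 * Num.sqrt (q%:R : realalg)
      & M%:R < 2 * Num.sqrt (q%:R : realalg)].
Proof.
(* Any odd m with M < 2 * 3^m would do. *)
pose m := M.*2.+1; have m_odd : odd m by rewrite /= odd_double.
have [F char3 cardF] := pPrimePowerField (isT : prime 3) (isT : 0 < m * 2)%N.
have three0 : 3 = 0 :> F by apply: pcharf0.
have {}cardF : #|F| = ((3 ^ m) ^ 2)%N by rewrite cardF expnM.
have [d d4] : exists d : F, d ^+ 4 = -1.
  apply: minus_one_fourth_power.
  rewrite cardF -expnM mulnC expnM -subn1 -eqn_mod_dvd ?expn_gt0 //.
  by rewrite -modnXm exp1n.
have sqrt_q : Num.sqrt (((3 ^ m) ^ 2)%N%:R : realalg) = (3 ^ m)%N%:R.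
  by rewrite natrX sqrtr_sqr ger0_norm ?ler0n.
exists (m * 2)%N, ((3 ^ m) ^ 2)%N, F, (as_curve (frac_three0 three0) ((y0poly m d ^+ 2)%:F)).
exists #|{: subfield_elt F m * bool}|; split=> //.
- by rewrite expnM.
- apply: (rank_of_spanning_free_family (g := generator three0 m_odd d4)).
    exact: generator_free.
  exact: generator_spans.
- by rewrite sqrt_q card_prod card_bool card_subfield_elt // natrM mulrC.
rewrite sqrt_q -natrM ltr_nat.
have : (m < 3 ^ m)%N by apply: ltn_expl.
by rewrite /m; clear; lia.
Qed.
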